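(* Let $\rho,\delta_{1\rho},\delta_{2\rho},\epsilon$ be real numbers such that $\rho>1/2$, $\frac{\pi}{2\rho}<\delta_{1\rho}\leqslant\min(\pi,\pi/\rho)$, $\frac{\pi}{2\rho}<\delta_{2\rho}\leqslant\min(\pi,\pi/\rho)$ and $\epsilon>0$. Let $\mu\in\mathbb{C}$ and let $z\in\mathbb{C}$ be such that $$\frac{\pi}{2\rho}-\delta_{2\rho}+\pi<\arg z<-\frac{\pi}{2\rho}+\delta_{1\rho}+\pi .$$ Then the Mittag-Leffler function $E_{\rho,\mu}$ can be represented in the form $$E_{\rho,\mu}(z)=\frac{\rho}{2\pi i}\int_{\gamma_\zeta}\frac{\exp\{(z\zeta)^{\rho}\}\,(z\zeta)^{\rho(1-\mu)}}{\zeta-1}\,d\zeta,$$ where the contour $\gamma_\zeta=\gamma_\zeta(\epsilon,\arg z,\delta_{1\rho},\delta_{2\rho})$ consists of the half-line $S_1=\{\zeta:\ \arg\zeta=-\delta_{1\rho}-\pi,\ |\zeta|\geqslant1+\epsilon\}$, the circular arc $C_\epsilon=\{\zeta:\ -\delta_{1\rho}-\pi\leqslant\arg\zeta\leqslant\delta_{2\rho}-\pi,\ |\zeta|=1+\epsilon\}$ and the half-line $S_2=\{\zeta:\ \arg\zeta=\delta_{2\rho}-\pi,\ |\zeta|\geqslant1+\epsilon\}$, traversed in this order in the positive direction.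
   Context: The two-parameter Mittag-Leffler function is the entire function $$E_{\rho,\mu}(z)=\sum_{n=0}^{\infty}\frac{z^n}{\Gamma(\mu+n/\rho)},\qquad \rho>0,\ \mu\in\mathbb{C},\ z\in\mathbb{C},$$ where $\Gamma$ is the Euler gamma function ($1/\Gamma$ being $0$ at the poles of $\Gamma$). The contour is traversed in the positive direction: $S_1$ from infinity to $|\zeta|=1+\epsilon$, then $C_\epsilon$ counterclockwise with $\arg\zeta$ increasing from $-\delta_{1\rho}-\pi$ to $\delta_{2\rho}-\pi$, then $S_2$ from $|\zeta|=1+\epsilon$ to infinity. Here $z\neq0$, $\arg z$ denotes the value of the argument of $z$ satisfying the stated inequality (it lies in $(\pi/2,3\pi/2)$), and $\arg\zeta$ has on each part of the contour the value(s) stated in its definition. Powers are defined by $(z\zeta)^{a}=\exp\{a(\ln|z\zeta|+i(\arg z+\arg\zeta))\}$ for $a\in\mathbb{C}$. *)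

(* Defs.v *)
(* Stdlib reals with Coquelicot: real improper integrals with values in
   Coquelicot's complex numbers C, seen as a normed space over R. *)
From Stdlib Require Import Reals ZArith Lra Lia.
From Coquelicot Require Import Coquelicot.

Open Scope R_scope.

Definition Cexp (w : C) : C :=
  (exp (Re w) * cos (Im w), exp (Re w) * sin (Im w)).

(* The point of modulus [r] and argument [theta], for [0 <= r]. *)
Definition polar (r theta : R) : C := (r * cos theta, r * sin theta).

Definition is_arg (z : C) (theta : R) : Prop :=
  z <> RtoC 0 /\ z = polar (Cmod z) theta.

(* [w^a] on the sheet where [w] has argument [theta]; [theta] need not be the
   principal argument. *)
Definition Cpow_arg (w : C) (theta : R) (a : C) : C :=
  Cexp (a * (RtoC (ln (Cmod w)) + Ci * RtoC theta)).

Definition is_CRInt_gen (f : R -> C) (Fa Fb : (R -> Prop) -> Prop) (l : C) :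
  Prop := is_RInt_gen (V := C_R_NormedModule) f Fa Fb l.

(* Componentwise sum of a complex series (a default value if it diverges). *)
Definition CSeries (a : nat -> C) : C :=
  (Series (fun n => Re (a n)), Series (fun n => Im (a n))).

(* Euler's integral, meaningful for [0 < Re s]. *)
Definition Gamma_int (s : C) : C :=
  RInt_gen (V := C_R_CompleteNormedModule)
    (fun t : R => Cpow_arg (RtoC t) 0 (s - RtoC 1) * RtoC (exp (- t)))%C
    (at_right 0) (Rbar_locally p_infty).

Fixpoint rising (s : C) (n : nat) : C :=
  match n with
  | O => RtoC 1
  | S k => (rising s k * (s + RtoC (INR k)))%C
  end.

(* The least natural number [n] such that [0 < Re s + n]. *)
Definition Gamma_shift (s : C) : nat := Z.to_nat (up (- Re s)).

(* Analytic continuation by the functional equation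
   Gamma (s + n) = s (s + 1) ... (s + n - 1) Gamma s.
   The denominator vanishes exactly at the poles 0, -1, -2, ...; since
   [Cinv 0 = 0], both [Gamma] and [/ Gamma] then take the value 0, the latter
   being the convention wanted for the reciprocal (see [Cinv_Gamma_pole]). *)
Definition Gamma (s : C) : C :=
  (Gamma_int (s + RtoC (INR (Gamma_shift s))) / rising s (Gamma_shift s))%C.

Definition Mittag_Leffler (rho : R) (mu z : C) : C :=
  CSeries (fun n => Cpow z n / Gamma (mu + RtoC (INR n / rho)))%C.

(* The integrand at the point zeta of modulus [s] and argument [theta], where
   [phi] is the chosen argument of [z]. It depends on [theta] itself and not
   only on zeta, hence the polar coordinates. *)
Definition ML_integrand (rho : R) (mu z : C) (phi s theta : R) : C :=
  let zeta := polar s theta in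
  (Cexp (Cpow_arg (z * zeta) (phi + theta) (RtoC rho))
   * Cpow_arg (z * zeta) (phi + theta) (RtoC rho * (RtoC 1 - mu))
   / (zeta - RtoC 1))%C.

(* [I] is the integral of [F s theta] d zeta, zeta = s e^{i theta}, along the
   half-line theta = - delta1 - PI taken from infinity to s = 1 + eps, then the
   arc s = 1 + eps counterclockwise, then the half-line theta = delta2 - PI out
   to infinity. On the half-lines d zeta = e^{i theta} ds, on the arc
   d zeta = i s e^{i theta} d theta. *)
Definition is_contour_integral (eps delta1 delta2 : R) (F : R -> R -> C)
    (I : C) : Prop :=
  exists I1 I2 I3 : C,
    is_CRInt_gen
      (fun s => F s (- delta1 - PI)%R * polar 1 (- delta1 - PI)%R)%C
      (Rbar_locally p_infty) (at_point (1 + eps)) I1 /\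
    is_RInt (V := C_R_NormedModule)
      (fun theta => F (1 + eps)%R theta * (Ci * polar (1 + eps)%R theta))%C
      (- delta1 - PI) (delta2 - PI) I2 /\
    is_CRInt_gen
      (fun s => F s (delta2 - PI)%R * polar 1 (delta2 - PI)%R)%C
      (at_point (1 + eps)) (Rbar_locally p_infty) I3 /\
    I = (I1 + I2 + I3)%C.

Lemma rising_pole (m n : nat) :
  (m < n)%nat -> rising (RtoC (- INR m)) n = RtoC 0.
Proof.
induction n as [|n IH]; intros Hmn; [lia|]; simpl.
destruct (Nat.eq_dec m n) as [<-|Hne].
- rewrite <- RtoC_plus, Rplus_opp_l; ring.
- rewrite IH by lia; ring.
Qed.

Lemma Cinv_Gamma_pole (m : nat) : (/ Gamma (RtoC (- INR m)))%C = RtoC 0.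
Proof.
assert (C0 : (/ RtoC 0)%C = RtoC 0).
{ unfold Cinv, RtoC; simpl; f_equal; unfold Rdiv; ring. }
unfold Gamma; rewrite rising_pole.
- unfold Cdiv; rewrite C0, Cmult_0_r; exact C0.
- unfold Gamma_shift; simpl; rewrite Ropp_involutive.
  destruct (archimed (INR m)) as [H _].
  rewrite INR_IZR_INZ in H at 2; apply lt_IZR in H.
  rewrite INR_IZR_INZ in H |- *; lia.
Qed.

(* Main.v *)
Require Import Defs.
From Stdlib Require Import Reals ZArith Lra Lia Psatz.
From Coquelicot Require Import Coquelicot.

Open Scope R_scope.

(** The theorem is Hankel's formula for 1 / Gamma combined with a geometric
    series. On the contour |zeta| >= 1 + eps, so zeta / (zeta - 1) is the sum of
    the powers zeta^(-n), uniformly. The substitution u = (z zeta)^rho turns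
    d zeta / zeta into (1 / rho) du / u and zeta^(-n) into z^n u^(-n / rho), and
    carries the contour to a Hankel contour: two rays whose arguments lie in
    (- 3 PI / 2, - PI / 2) and (PI / 2, 3 PI / 2), joined by an arc. The n-th term
    of the series becomes z^n times the Hankel integral of
    e^u u^(- (mu + n / rho)) du, which is 2 PI i / Gamma (mu + n / rho). Since the
    remainder after n terms is the integrand times zeta^(-n), its integral is at
    most a constant times (1 + eps)^(-n) ([Mittag_Leffler_half_strip]).

    All integrals are taken in the coordinate w = ln u, that is u = e^w, where the
    powers of u are entire functions and a Hankel contour is the boundary of a
    half-strip [on_half_strip]: Cauchy's theorem is then needed for rectangles
    only, where it is differentiation under the integral sign
    ([Cauchy_rectangle]).

    Hankel's formula ([inv_Gamma_hankel]) is obtained without the reflection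
    formula. Write H(s) for the integral of e^u u^(-s) du. Integration by parts
    gives H(s) = s H(s + 1), so one may suppose Re s > 0. Consider, on a contour
    with arc of radius less than 1,

      Phi(T) = integral of e^(T (u - 1)) u^(-s) / (u - 1) du.

    Its derivative is e^(-T) times the integral of e^(T u) u^(-s) du, which by the
    substitution u -> u / T is e^(-T) T^(s - 1) H(s): Euler's integrand times H(s).
    As Phi tends to 0 at infinity, Gamma(s) H(s) = - Phi(0)
    ([is_gamma_integral]). The number Phi(0) is the integral of
    u^(-s) / (u - 1) du. It would be 0 if the arc had radius greater than 1, because
    one could push the arc to infinity; crossing the pole u = 1 changes it by
    - 2 PI i ([is_half_strip_int_pole_kernel_neg]). That residue is computed from
    the difference of 1 / (u - 1) on the circles of radii e^(-h) and e^h, which is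
    minus a Poisson kernel, as h tends to 0. *)

(** * Componentwise calculus of complex-valued functions of a real variable *)

(** Componentwise, so that each rule of the calculus reduces to the real one. *)
Definition is_Cderive (f : R -> C) (t : R) (d : C) : Prop :=
  is_derive (fun u => Re (f u)) t (Re d) /\
  is_derive (fun u => Im (f u)) t (Im d).

Lemma is_Cderive_eq f t d d' : is_Cderive f t d -> d = d' -> is_Cderive f t d'.
Proof. now intros H <-. Qed.

Lemma is_Cderive_const c t : is_Cderive (fun _ => c) t (RtoC 0).
Proof. split; simpl; auto_derive; auto. Qed.

Lemma is_Cderive_plus f g t df dg :
  is_Cderive f t df -> is_Cderive g t dg ->
  is_Cderive (fun u => (f u + g u)%C) t (df + dg)%C.
Proof.
intros [H1 H2] [H3 H4]; split; simpl.
- exact (is_derive_plus _ _ _ _ _ H1 H3).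
- exact (is_derive_plus _ _ _ _ _ H2 H4).
Qed.

Lemma is_derive_Rmult (f g : R -> R) t df dg :
  is_derive f t df -> is_derive g t dg ->
  is_derive (fun u => f u * g u) t (df * g t + f t * dg).
Proof.
intros H1 H2. 
apply (is_derive_mult f g t df dg H1 H2). intros; apply Rmult_comm.
Qed.

Lemma is_Cderive_mult f g t df dg :
  is_Cderive f t df -> is_Cderive g t dg ->
  is_Cderive (fun u => (f u * g u)%C) t (df * g t + f t * dg)%C.
Proof.
intros [H1 H2] [H3 H4]; split; simpl.
- pose proof (is_derive_minus _ _ _ _ _ (is_derive_Rmult _ _ _ _ _ H1 H3)
     (is_derive_Rmult _ _ _ _ _ H2 H4)) as H.
  unfold minus, plus, opp in H; simpl in H.
  evar_last; [exact H | unfold Re, Im; ring].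
- pose proof (is_derive_plus _ _ _ _ _ (is_derive_Rmult _ _ _ _ _ H1 H4)
     (is_derive_Rmult _ _ _ _ _ H2 H3)) as H.
  unfold minus, plus, opp in H; simpl in H.
  evar_last; [exact H | unfold Re, Im; ring].
Qed.

Lemma is_Cderive_opp f t df :
  is_Cderive f t df -> is_Cderive (fun u => (- f u)%C) t (- df)%C.
Proof.
intros [H1 H2]; split; simpl;
  [exact (is_derive_opp _ _ _ H1) | exact (is_derive_opp _ _ _ H2)].
Qed.

Lemma is_Cderive_minus f g t df dg :
  is_Cderive f t df -> is_Cderive g t dg ->
  is_Cderive (fun u => (f u - g u)%C) t (df - dg)%C.
Proof. intros H1 H2; apply is_Cderive_plus; auto; now apply is_Cderive_opp. Qed.

Ltac real_derive a b t da db H1 H2 :=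
  let E1 := fresh in let E2 := fresh in
  pose proof (ex_intro _ _ H1 : ex_derive a t) as E1;
  pose proof (ex_intro _ _ H2 : ex_derive b t) as E2;
  apply is_derive_unique in H1; apply is_derive_unique in H2;
  auto_derive; auto;
  change (Derive (fun x => a x) t) with (Derive a t);
  change (Derive (fun x => b x) t) with (Derive b t);
  rewrite H1, H2.

Lemma is_derive_exp_cos (a b : R -> R) t da db :
  is_derive a t da -> is_derive b t db ->
  is_derive (fun u => exp (a u) * cos (b u)) t
    (exp (a t) * (da * cos (b t) - db * sin (b t))).
Proof. intros H1 H2; real_derive a b t da db H1 H2; ring. Qed.

Lemma is_derive_exp_sin (a b : R -> R) t da db :
  is_derive a t da -> is_derive b t db ->
  is_derive (fun u => exp (a u) * sin (b u)) t
    (exp (a t) * (da * sin (b t) + db * cos (b t))).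
Proof. intros H1 H2; real_derive a b t da db H1 H2; ring. Qed.

Lemma is_Cderive_Cexp f t df :
  is_Cderive f t df -> is_Cderive (fun u => Cexp (f u)) t (df * Cexp (f t))%C.
Proof.
intros [H1 H2]; split; simpl.
- evar_last; [exact (is_derive_exp_cos _ _ _ _ _ H1 H2)|unfold Re, Im; ring].
- evar_last; [exact (is_derive_exp_sin _ _ _ _ _ H1 H2)|unfold Re, Im; ring].
Qed.

Lemma Csqr_pos (z : C) : z <> RtoC 0 -> Re z ^ 2 + Im z ^ 2 <> 0.
Proof.
intros H; rewrite <- Cmod2_alt.
apply Cmod_gt_0 in H; apply pow_nonzero; lra.
Qed.

Lemma is_derive_div_sqr (a b : R -> R) t da db :
  is_derive a t da -> is_derive b t db -> a t ^ 2 + b t ^ 2 <> 0 ->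
  is_derive (fun u => a u / (a u ^ 2 + b u ^ 2)) t
    ((da * (b t ^ 2 - a t ^ 2) - 2 * a t * b t * db) / (a t ^ 2 + b t ^ 2) ^ 2).
Proof.
intros H1 H2 H0; real_derive a b t da db H1 H2; simpl in *; rewrite ?Rmult_1_r in *; field; auto.
Qed.

Lemma is_Cderive_inv f t df :
  is_Cderive f t df -> f t <> RtoC 0 ->
  is_Cderive (fun u => (/ f u)%C) t (- df * / f t * / f t)%C.
Proof.
intros [H1 H2] H0; apply Csqr_pos in H0.
assert (H0' : Im (f t) ^ 2 + Re (f t) ^ 2 <> 0) by (now rewrite Rplus_comm).
split.
- evar_last; [exact (is_derive_div_sqr _ _ _ _ _ H1 H2 H0)|].
  unfold Re, Im in *; simpl in *; field.
  rewrite !Rmult_1_r in H0; exact H0.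
- apply is_derive_ext with
    (fun u => - (Im (f u) / (Im (f u) ^ 2 + Re (f u) ^ 2))).
  { intros u; unfold Re, Im; simpl; rewrite Rplus_comm; unfold Rdiv; ring. }
  evar_last; [exact (is_derive_opp _ _ _ (is_derive_div_sqr _ _ _ _ _ H2 H1 H0'))|].
  unfold Re, Im, opp in *; simpl in *; field.
  rewrite !Rmult_1_r in H0, H0'; first [assumption | split; assumption].
Qed.

Lemma is_Cderive_RtoC g t dg :
  is_derive g t dg -> is_Cderive (fun u => RtoC (g u)) t (RtoC dg).
Proof. intros H; split; simpl; [exact H|]; auto_derive; auto. Qed.

Lemma is_Cderive_re y t : is_Cderive (fun u => (u, y) : C) t (RtoC 1).
Proof. split; simpl; auto_derive; auto. Qed.

Lemma is_Cderive_im x t : is_Cderive (fun u => (x, u) : C) t Ci.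
Proof. split; simpl; auto_derive; auto. Qed.

(** * The complex exponential *)

Lemma Cexp_plus u v : Cexp (u + v) = (Cexp u * Cexp v)%C.
Proof.
unfold Cexp, Cmult, Cplus, Re, Im; simpl.
rewrite exp_plus, cos_plus, sin_plus; f_equal; ring.
Qed.

Lemma Cexp_0 : Cexp (RtoC 0) = RtoC 1.
Proof. unfold Cexp, RtoC; simpl; rewrite exp_0, cos_0, sin_0; f_equal; ring. Qed.

Lemma Cexp_RtoC x : Cexp (RtoC x) = RtoC (exp x).
Proof. unfold Cexp, RtoC; simpl; rewrite cos_0, sin_0; f_equal; ring. Qed.

Lemma Cmod_Cexp u : Cmod (Cexp u) = exp (Re u).
Proof.
unfold Cexp, Cmod; simpl.
replace (_ + _) with (Rsqr (exp (Re u))).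
- apply sqrt_Rsqr; left; apply exp_pos.
- assert (H := sin2_cos2 (Im u)); unfold Rsqr in *.
  transitivity (exp (Re u) * exp (Re u)
    * (sin (Im u) * sin (Im u) + cos (Im u) * cos (Im u))); [rewrite H|]; ring.
Qed.

Lemma Cexp_neq_0 u : Cexp u <> RtoC 0.
Proof. apply Cmod_gt_0; rewrite Cmod_Cexp; apply exp_pos. Qed.

Lemma Cexp_opp u : Cexp (- u) = (/ Cexp u)%C.
Proof.
assert (H := Cexp_neq_0 u).
assert (E : (Cexp (- u) * Cexp u)%C = RtoC 1).
{ rewrite <- Cexp_plus; replace (- u + u)%C with (RtoC 0) by ring; apply Cexp_0. }
rewrite <- (Cmult_1_r (Cexp (- u))), <- (Cinv_r (Cexp u)) by auto.
rewrite Cmult_assoc, E; ring.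
Qed.

Lemma Cmod_minus_sym a b : Cmod (a - b) = Cmod (b - a).
Proof. rewrite <- Cmod_opp; f_equal; ring. Qed.

Lemma im_le_Cmod c : Rabs (Im c) <= Cmod c.
Proof. eapply Rle_trans; [|apply Rmax_Cmod]; apply Rmax_r. Qed.

Lemma Cmod_le_sum (c : C) : Cmod c <= Rabs (Re c) + Rabs (Im c).
Proof.
replace c with (RtoC (Re c) + Ci * RtoC (Im c))%C at 1.
2: { destruct c; unfold RtoC, Ci, Cmult, Cplus, Re, Im; simpl; f_equal; ring. }
eapply Rle_trans; [apply Cmod_triangle|].
rewrite Cmod_mult, Cmod_Ci, !Cmod_R; lra.
Qed.

Lemma is_derive_continuity_pt g t d : is_derive g t d -> continuity_pt g t.
Proof.
intros H; apply continuity_pt_filterlim, (ex_derive_continuous g).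
now exists d.
Qed.

(** The component of [f] in the direction of [f 1 - f 0] is a real function, to
    which the mean value theorem applies. *)
Lemma Cmod_mean_value (f df : R -> C) (M : R) :
  (forall t, 0 <= t <= 1 -> is_Cderive f t (df t)) ->
  (forall t, 0 <= t <= 1 -> Cmod (df t) <= M) ->
  Cmod (f 1 - f 0) <= M.
Proof.
intros Hd HM.
set (c := (f 1 - f 0)%C).
set (g := fun t => Re (Cconj c * f t)%C).
assert (Hg : forall t, 0 <= t <= 1 -> is_derive g t (Re (Cconj c * df t)%C)).
{ intros t Ht.
  pose proof (proj1 (is_Cderive_mult _ _ _ _ _ (is_Cderive_const (Cconj c) t) (Hd t Ht))) as H.
  evar_last; [exact H|]; unfold Re, Im; simpl; ring. }
assert (m0 : Rmin 0 1 = 0) by (apply Rmin_left; lra).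
assert (m1 : Rmax 0 1 = 1) by (apply Rmax_right; lra).
assert (mvt := MVT_gen g 0 1 (fun t => Re (Cconj c * df t)%C)).
cbv zeta in mvt; rewrite m0, m1 in mvt.
destruct mvt as [x [Hx E]].
- intros; apply Hg; lra.
- intros t Ht; eapply is_derive_continuity_pt, Hg; lra.
- assert (E2 : g 1 - g 0 = Cmod c ^ 2).
  { rewrite Cmod2_alt; unfold g.
    replace (Re (Cconj c * f 1) - Re (Cconj c * f 0)) with (Re (Cconj c * c)).
    - unfold Cconj, Re, Im; simpl; ring.
    - unfold c; unfold Re; simpl; ring. }
  rewrite E2 in E.
  assert (H := re_le_Cmod (Cconj c * df x)).
  rewrite Cmod_mult, Cmod_conj in H.
  assert (H2 := Rle_abs (Re (Cconj c * df x))).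
  assert (H3 := HM x Hx).
  assert (H4 := Cmod_ge_0 c).
  destruct (Rle_lt_or_eq_dec _ _ H4) as [H5|H5].
  + apply Rmult_le_reg_l with (Cmod c); auto.
    apply Rle_trans with (Cmod c * Cmod (df x)); [replace (Cmod c * Cmod c) with (Cmod c ^ 2) by ring; rewrite E; lra|].
    apply Rmult_le_compat_l; auto.
  + rewrite <- H5; eapply Rle_trans; [apply Cmod_ge_0|exact H3].
Qed.

Lemma exp_le_mono x y : x <= y -> exp x <= exp y.
Proof. intros [H| ->]; [left; now apply exp_increasing | right; auto]. Qed.

Lemma Re_scal t (v : C) : Re (RtoC t * v) = t * Re v.
Proof. unfold Re, RtoC; simpl; ring. Qed.
Lemma is_Cderive_Cexp_line (v : C) t :
  is_Cderive (fun u => Cexp (RtoC u * v)) t (v * Cexp (RtoC t * v))%C.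
Proof.
eapply is_Cderive_eq.
- apply is_Cderive_Cexp, is_Cderive_mult; [|apply is_Cderive_const].
  apply is_Cderive_RtoC, is_derive_id.
- unfold one; simpl; ring.
Qed.

Lemma exp_le_1 x : x <= 0 -> exp x <= 1.
Proof. intros H; rewrite <- exp_0; now apply exp_le_mono. Qed.

Lemma Cexp_line_le_1 v t : Re v <= 0 -> 0 <= t <= 1 -> Cmod (Cexp (RtoC t * v)) <= 1.
Proof. intros; rewrite Cmod_Cexp, Re_scal; apply exp_le_1; nra. Qed.

Lemma Cexp_sub_1_bound_gen v B : Cmod v <= B -> Cmod (Cexp v - 1) <= exp B * Cmod v.
Proof.
intros H.
replace (Cexp v - 1)%C with (Cexp (RtoC 1 * v) - Cexp (RtoC 0 * v))%C
  by (rewrite Cmult_1_l, Cmult_0_l, Cexp_0; ring).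
apply (Cmod_mean_value (fun t => Cexp (RtoC t * v)) (fun t => v * Cexp (RtoC t * v))%C).
- intros; apply is_Cderive_Cexp_line.
- intros t Ht; rewrite Cmod_mult, Cmod_Cexp, Re_scal, Rmult_comm.
  apply Rmult_le_compat_r; [apply Cmod_ge_0|].
  apply exp_le_mono. assert (H1 := re_le_Cmod v). assert (H2 := Rle_abs (Re v)).
  assert (H3 := Cmod_ge_0 v). nra.
Qed.

Lemma Cexp_sub_1_bound v : Re v <= 0 -> Cmod (Cexp v - 1) <= Cmod v.
Proof.
intros H.
replace (Cexp v - 1)%C with (Cexp (RtoC 1 * v) - Cexp (RtoC 0 * v))%C
  by (rewrite Cmult_1_l, Cmult_0_l, Cexp_0; ring).
apply (Cmod_mean_value (fun t => Cexp (RtoC t * v)) (fun t => v * Cexp (RtoC t * v))%C).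
- intros; apply is_Cderive_Cexp_line.
- intros t Ht; rewrite Cmod_mult.
  assert (H3 := Cmod_ge_0 v). assert (H4 := Cexp_line_le_1 v t H Ht). nra.
Qed.

(** This bound and the next one serve to differentiate T |-> exp (T u), Re u <= 0.
    For an increment h > 0 the factor exp (T u) is taken out and v = h u; for h < 0
    the factor exp ((T + h) u) is taken out and v = - h u, which leads to the
    expansion about the other end of the segment from 0 to v. *)
Lemma Cexp_taylor_at_0 v : Re v <= 0 -> Cmod (Cexp v - 1 - v) <= Cmod v ^ 2.
Proof.
intros H.
replace (Cexp v - 1 - v)%C
  with ((Cexp (RtoC 1 * v) - RtoC 1 * v) - (Cexp (RtoC 0 * v) - RtoC 0 * v))%C
  by (rewrite Cmult_1_l, Cmult_0_l, Cexp_0; ring).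
apply (Cmod_mean_value (fun t => Cexp (RtoC t * v) - RtoC t * v)%C
  (fun t => v * (Cexp (RtoC t * v) - 1))%C).
- intros; eapply is_Cderive_eq.
  + apply is_Cderive_minus; [apply is_Cderive_Cexp_line|].
    apply is_Cderive_mult; [|apply is_Cderive_const].
    apply is_Cderive_RtoC, is_derive_id.
  + unfold one; simpl; ring.
- intros t Ht; rewrite Cmod_mult.
  assert (H3 := Cmod_ge_0 v).
  assert (H4 : Cmod (Cexp (RtoC t * v) - 1) <= Cmod (RtoC t * v)).
  { apply Cexp_sub_1_bound; rewrite Re_scal; nra. }
  rewrite Cmod_mult, Cmod_R, Rabs_pos_eq in H4 by lra.
  assert (t * Cmod v <= Cmod v) by nra. simpl; nra.
Qed.

Lemma Cexp_taylor_at_end v :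
  Re v <= 0 -> Cmod (1 - Cexp v + v * Cexp v) <= Cmod v ^ 2.
Proof.
intros H.
replace (1 - Cexp v + v * Cexp v)%C
  with ((RtoC 1 * v * Cexp (RtoC 1 * v) - Cexp (RtoC 1 * v))
        - (RtoC 0 * v * Cexp (RtoC 0 * v) - Cexp (RtoC 0 * v)))%C
  by (rewrite Cmult_1_l, Cmult_0_l, Cexp_0; ring).
apply (Cmod_mean_value (fun t => RtoC t * v * Cexp (RtoC t * v) - Cexp (RtoC t * v))%C
  (fun t => RtoC t * v * v * Cexp (RtoC t * v))%C).
- intros; eapply is_Cderive_eq.
  + apply is_Cderive_minus; [|apply is_Cderive_Cexp_line].
    apply is_Cderive_mult; [|apply is_Cderive_Cexp_line].
    apply is_Cderive_mult; [|apply is_Cderive_const].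
    apply is_Cderive_RtoC, is_derive_id.
  + unfold one; simpl; ring.
- intros t Ht; rewrite !Cmod_mult, Cmod_R, Rabs_pos_eq by lra.
  assert (H3 := Cmod_ge_0 v). assert (H4 := Cexp_line_le_1 v t H Ht).
  assert (H5 := Cmod_ge_0 (Cexp (RtoC t * v))).
  assert (0 <= t * Cmod v * Cmod v <= Cmod v ^ 2) by (simpl; nra). nra.
Qed.

(** * Integrals of complex-valued functions *)

Notation CV := C_R_CompleteNormedModule.
Notation CN := C_R_NormedModule.

Lemma norm_Cmod (c : C) : norm (V := CN) c = Cmod c.
Proof.
unfold norm; simpl; unfold prod_norm, Cmod, norm; simpl; unfold abs; simpl.
f_equal; rewrite !Rmult_1_r.
now rewrite <- !Rabs_mult, !Rabs_pos_eq by (apply Rle_0_sqr).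
Qed.

Lemma filterlim_C {T} (F : (T -> Prop) -> Prop) {FF : Filter F} (f : T -> C) (l : C) :
  filterlim (fun t => Re (f t)) F (locally (Re l)) ->
  filterlim (fun t => Im (f t)) F (locally (Im l)) ->
  filterlim f F (locally (T := CN) l).
Proof.
intros H1 H2 P [eps HP].
assert (A1 := H1 (fun x => ball (Re l) eps x) (locally_ball _ eps)).
assert (A2 := H2 (fun x => ball (Im l) eps x) (locally_ball _ eps)).
unfold filtermap in *.
generalize (filter_and _ _ A1 A2); apply filter_imp.
intros t [B1 B2]; apply HP; split; assumption.
Qed.

Lemma filterlim_C_norm {T} (F : (T -> Prop) -> Prop) {FF : Filter F} (f : T -> C) (l : C)
  (g : T -> R) :
  filterlim g F (locally 0) ->
  F (fun t => Cmod (f t - l) <= g t) ->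
  filterlim f F (locally (T := CN) l).
Proof.
intros Hg Hb.
assert (Hgen : forall p : C -> R, (forall c, Rabs (p c) <= Cmod c) ->
  (forall a b, p (a - b)%C = p a - p b) ->
  filterlim (fun t => p (f t)) F (locally (p l))).
{ intros p Hp Hm P [eps HP].
  assert (A := Hg _ (locally_ball 0 eps)).
  unfold filtermap in *.
  generalize (filter_and _ _ A Hb); apply filter_imp.
  intros t [B1 B2]; apply HP.
  unfold ball in *; simpl in *; unfold AbsRing_ball, abs, minus, plus, opp in *; simpl in *.
  rewrite Ropp_0, Rplus_0_r in B1.
  change (Rabs (p (f t) - p l) < eps); rewrite <- Hm.
  eapply Rle_lt_trans; [apply Hp|].
  eapply Rle_lt_trans; [exact B2|]. eapply Rle_lt_trans; [apply Rle_abs|exact B1]. }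
apply filterlim_C; auto; apply Hgen.
- apply re_le_Cmod.
- intros; unfold Re; simpl; ring.
- apply im_le_Cmod.
- intros; unfold Im; simpl; ring.
Qed.

Lemma filterlim_Re (l : C) : filterlim Re (locally (T := CN) l) (locally (Re l)).
Proof. intros P [eps HP]; exists eps; intros y [Hy _]; apply HP; exact Hy. Qed.

Lemma filterlim_Im (l : C) : filterlim Im (locally (T := CN) l) (locally (Im l)).
Proof. intros P [eps HP]; exists eps; intros y [_ Hy]; apply HP; exact Hy. Qed.

Lemma filterlim_Cmult_const (c l : C) :
  filterlim (fun y => (c * y)%C) (locally (T := CN) l) (locally (T := CN) (c * l)%C).
Proof.
assert (Hs : forall (p : C -> R) (k : R), filterlim p (locally (T := CN) l) (locally (p l)) ->
   filterlim (fun y => k * p y) (locally (T := CN) l) (locally (k * p l))).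
{ intros p k Hp. apply filterlim_comp with (1 := Hp). apply (filterlim_scal_r k (p l)). }
apply filterlim_C; [typeclasses eauto|..].
- apply (filterlim_comp_2 (G := locally (Re c * Re l)) (H := locally (- (Im c * Im l)))
    (fun y : C => Re c * Re y) (fun y : C => - (Im c * Im y)) Rplus).
  + apply Hs, filterlim_Re.
  + eapply filterlim_comp; [apply Hs, filterlim_Im | apply (filterlim_opp (Im c * Im l))].
  + apply (filterlim_plus (Re c * Re l) (- (Im c * Im l))).
- apply (filterlim_comp_2 (G := locally (Re c * Im l)) (H := locally (Im c * Re l))
    (fun y : C => Re c * Im y) (fun y : C => Im c * Re y) Rplus).
  + apply Hs, filterlim_Im.
  + apply Hs, filterlim_Re.
  + apply (filterlim_plus (Re c * Im l) (Im c * Re l)).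
Qed.

Definition Ccont (f : R -> C) (t : R) := continuous (U := CV) f t.

Lemma is_Cderive_continuous f t d : is_Cderive f t d -> Ccont f t.
Proof.
intros [H1 H2]; apply filterlim_C; [typeclasses eauto|..].
- apply (ex_derive_continuous (fun u => Re (f u))); eexists; exact H1.
- apply (ex_derive_continuous (fun u => Im (f u))); eexists; exact H2.
Qed.

Lemma is_RInt_C f a b (l : C) :
  is_RInt (fun t => Re (f t)) a b (Re l) -> is_RInt (fun t => Im (f t)) a b (Im l) ->
  is_RInt (V := CN) f a b l.
Proof.
intros H1 H2. destruct l as [l1 l2].
exact (is_RInt_fct_extend_pair (U := R_NormedModule) (V := R_NormedModule) f a b l1 l2 H1 H2).
Qed.

Lemma is_RInt_C_Re f a b (l : C) : is_RInt (V := CN) f a b l -> is_RInt (fun t => Re (f t)) a b (Re l).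
Proof. exact (is_RInt_fct_extend_fst (U := R_NormedModule) (V := R_NormedModule) f a b l). Qed.

Lemma is_RInt_C_Im f a b (l : C) : is_RInt (V := CN) f a b l -> is_RInt (fun t => Im (f t)) a b (Im l).
Proof. exact (is_RInt_fct_extend_snd (U := R_NormedModule) (V := R_NormedModule) f a b l). Qed.

Lemma is_RInt_Cmult_const c f a b l :
  is_RInt (V := CN) f a b l -> is_RInt (V := CN) (fun t => c * f t)%C a b (c * l)%C.
Proof.
intros H; assert (H1 := is_RInt_C_Re _ _ _ _ H); assert (H2 := is_RInt_C_Im _ _ _ _ H).
apply is_RInt_C.
- exact (is_RInt_minus _ _ _ _ _ _ (is_RInt_scal _ _ _ (Re c) _ H1) (is_RInt_scal _ _ _ (Im c) _ H2)).
- exact (is_RInt_plus _ _ _ _ _ _ (is_RInt_scal _ _ _ (Re c) _ H2) (is_RInt_scal _ _ _ (Im c) _ H1)).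
Qed.

Lemma Ccont_Re f t : Ccont f t -> continuous (fun u => Re (f u)) t.
Proof. intros H; eapply filterlim_comp; [exact H|apply filterlim_Re]. Qed.
Lemma Ccont_Im f t : Ccont f t -> continuous (fun u => Im (f u)) t.
Proof. intros H; eapply filterlim_comp; [exact H|apply filterlim_Im]. Qed.

Lemma is_RInt_Cderive f df a b : a <= b ->
  (forall t, a <= t <= b -> is_Cderive f t (df t)) ->
  (forall t, a <= t <= b -> Ccont df t) ->
  is_RInt (V := CN) df a b (f b - f a)%C.
Proof.
intros Hab Hd Hc; apply is_RInt_C.
- apply (is_RInt_derive (V := R_CompleteNormedModule) (fun t => Re (f t)));
  rewrite Rmin_left, Rmax_right by auto; intros t Ht;
  [apply Hd | apply Ccont_Re]; auto.
- apply (is_RInt_derive (V := R_CompleteNormedModule) (fun t => Im (f t)));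
  rewrite Rmin_left, Rmax_right by auto; intros t Ht;
  [apply Hd | apply Ccont_Im]; auto.
Qed.

Lemma ex_RInt_Ccont f a b : a <= b ->
  (forall t, a <= t <= b -> Ccont f t) -> is_RInt (V := CN) f a b (RInt (V := CV) f a b).
Proof.
intros Hab Hc. apply (RInt_correct (V := CV)), (ex_RInt_continuous (V := CV)).
rewrite Rmin_left, Rmax_right by auto; exact Hc.
Qed.

Lemma is_RInt_C_unique f a b l l' :
  is_RInt (V := CN) f a b l -> is_RInt (V := CN) f a b l' -> l = l'.
Proof.
intros H1 H2.
now rewrite <- (is_RInt_unique (V := CV) f a b l H1), <- (is_RInt_unique (V := CV) f a b l' H2).
Qed.

Lemma Cmod_RInt_le f g a b (l : C) lg : a <= b ->
  (forall t, a <= t <= b -> Cmod (f t) <= g t) ->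
  is_RInt (V := CN) f a b l -> is_RInt g a b lg -> Cmod l <= lg.
Proof.
intros Hab H H1 H2; rewrite <- norm_Cmod.
apply (norm_RInt_le (V := CN) f g a b l lg Hab); auto.
intros t Ht; rewrite norm_Cmod; auto.
Qed.

(** * Improper integrals over a half-line *)

Definition is_RInt_infty (f : R -> C) (x0 : R) (l : C) : Prop :=
  is_RInt_gen (V := CN) f (at_point x0) (Rbar_locally p_infty) l.

Lemma eventually_ge x0 : Rbar_locally p_infty (fun b => x0 <= b).
Proof. exists x0; intros; lra. Qed.

Lemma is_RInt_infty_intro f x0 (P : R -> C) l :
  (forall b, x0 <= b -> is_RInt (V := CN) f x0 b (P b)) ->
  filterlim P (Rbar_locally p_infty) (locally (T := CN) l) ->
  is_RInt_infty f x0 l.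
Proof.
intros H HP Q HQ.
assert (A := HP Q HQ); unfold filtermap in A.
exists (fun a => a = x0) (fun b => x0 <= b /\ Q (P b)).
- reflexivity.
- apply filter_and; [apply eventually_ge | exact A].
- intros a b -> [Hb Hq]; exists (P b); simpl; auto.
Qed.

Lemma is_RInt_infty_elim f x0 (P : R -> C) l :
  (forall b, x0 <= b -> is_RInt (V := CN) f x0 b (P b)) ->
  is_RInt_infty f x0 l ->
  filterlim P (Rbar_locally p_infty) (locally (T := CN) l).
Proof.
intros H HP Q HQ.
destruct (HP Q HQ) as [A B HA HB HAB].
unfold filtermap.
generalize (filter_and _ _ (eventually_ge x0) HB); apply filter_imp.
intros b [Hb HBb].
destruct (HAB x0 b HA HBb) as [y [Hy1 Hy2]]; simpl in Hy1.
now rewrite (is_RInt_C_unique _ _ _ _ _ (H b Hb) Hy1).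
Qed.

Lemma is_RInt_infty_unique f x0 l l' : is_RInt_infty f x0 l -> is_RInt_infty f x0 l' -> l = l'.
Proof.
intros H1 H2.
rewrite <- (is_RInt_gen_unique (V := CV) f l H1).
exact (is_RInt_gen_unique (V := CV) f l' H2).
Qed.

Lemma is_RInt_infty_ext f g x0 l :
  (forall x, x0 < x -> f x = g x) -> is_RInt_infty f x0 l -> is_RInt_infty g x0 l.
Proof.
intros E H; apply (is_RInt_gen_ext (V := CN) f g l); auto.
exists (fun a => a = x0) (fun b => x0 <= b).
- reflexivity.
- apply eventually_ge.
- intros a b -> Hb x; simpl; rewrite Rmin_left by auto; intros; apply E; lra.
Qed.

Lemma is_RInt_infty_plus f g x0 lf lg : is_RInt_infty f x0 lf -> is_RInt_infty g x0 lg ->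
  is_RInt_infty (fun x => f x + g x)%C x0 (lf + lg)%C.
Proof. exact (is_RInt_gen_plus (V := CN) f g lf lg). Qed.

Lemma is_RInt_infty_mult c f x0 l : is_RInt_infty f x0 l -> is_RInt_infty (fun x => c * f x)%C x0 (c * l)%C.
Proof.
intros H Q HQ.
assert (HQ' := filterlim_Cmult_const c l Q HQ).
destruct (H _ HQ') as [A B HA HB HAB].
exists A B; auto.
intros a b Ha Hb; destruct (HAB a b Ha Hb) as [y [Hy1 Hy2]].
exists (c * y)%C; split; auto.
now apply is_RInt_Cmult_const.
Qed.

Lemma is_RInt_infty_Chasles f x0 x1 l1 l : is_RInt (V := CN) f x0 x1 l1 -> is_RInt_infty f x1 l ->
  is_RInt_infty f x0 (l1 + l)%C.
Proof.
intros H1 H2; apply (is_RInt_gen_Chasles (V := CN) f x1 l1 l); auto.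
now apply (is_RInt_gen_at_point (V := CN)).
Qed.

Lemma is_RInt_exp k a b : k <> 0 ->
  is_RInt (fun x => exp (- k * x)) a b ((exp (- k * a) - exp (- k * b)) / k).
Proof.
intros Hk.
evar_last.
- apply (is_RInt_derive (V := R_CompleteNormedModule) (fun x => - exp (- k * x) / k)).
  + intros x _; auto_derive; auto; field; auto.
  + intros x _; apply (ex_derive_continuous (fun x => exp (- k * x))).
    auto_derive; auto.
- unfold minus, plus, opp; simpl; field; auto.
Qed.

Lemma filterlim_exp_minus k : 0 < k ->
  filterlim (fun x => exp (- k * x)) (Rbar_locally p_infty) (locally 0).
Proof.
intros Hk P [eps HP].
exists (- ln eps / k); intros x Hx; apply HP.
unfold ball; simpl; unfold AbsRing_ball, abs, minus, plus, opp; simpl.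
rewrite Ropp_0, Rplus_0_r, Rabs_pos_eq by (left; apply exp_pos).
rewrite <- (exp_ln eps) by apply cond_pos; apply exp_increasing.
apply Rmult_lt_compat_l with (r := k) in Hx; auto.
replace (k * (- ln eps / k)) with (- ln eps) in Hx by (field; lra). lra.
Qed.

Lemma Cmod_RInt_exp_le f k M a b (l : C) : 0 < k -> a <= b ->
  (forall x, a <= x <= b -> Cmod (f x) <= M * exp (- k * x)) ->
  is_RInt (V := CN) f a b l -> Cmod l <= M / k * (exp (- k * a) - exp (- k * b)).
Proof.
intros Hk Hab H Hl.
replace (M / k * (exp (- k * a) - exp (- k * b)))
  with (M * ((exp (- k * a) - exp (- k * b)) / k)) by (field; lra).
apply (Cmod_RInt_le f (fun x => M * exp (- k * x)) a b); auto.
apply (is_RInt_scal (V := R_NormedModule)), is_RInt_exp; lra.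
Qed.

Lemma bound_nonneg (f : R -> C) k M x0 :
  (forall x, x0 <= x -> Cmod (f x) <= M * exp (- k * x)) -> 0 <= M.
Proof.
intros H; specialize (H x0 (Rle_refl _)).
assert (H1 := Cmod_ge_0 (f x0)); assert (H2 := exp_pos (- k * x0)); nra.
Qed.

(** Exponential decay makes the integrals over [x0, b] a Cauchy family as b
    tends to infinity. *)
Lemma ex_RInt_infty f k M x0 : 0 < k ->
  (forall x, x0 <= x -> Ccont f x) ->
  (forall x, x0 <= x -> Cmod (f x) <= M * exp (- k * x)) ->
  exists l, is_RInt_infty f x0 l.
Proof.
intros Hk Hc Hb.
assert (HM := bound_nonneg _ _ _ _ Hb).
assert (HI : forall a b, x0 <= a -> a <= b -> is_RInt (V := CN) f a b (RInt (V := CV) f a b)).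
{ intros a b Ha Hab; apply ex_RInt_Ccont; auto; intros; apply Hc; lra. }
destruct (proj1 (filterlim_locally_cauchy (U := CV) (F := Rbar_locally p_infty)
  (fun b => RInt (V := CV) f x0 b))) as [l Hl].
- intros eps.
  assert (He : 0 < eps / (M / k + 1)).
  { apply Rdiv_lt_0_compat; [apply cond_pos|].
    assert (0 <= M / k) by (apply Rle_mult_inv_pos; auto). lra. }
  set (e := mkposreal _ He).
  destruct (filterlim_exp_minus k Hk _ (locally_ball 0 e)) as [B HB].
  assert (key : forall u v, x0 <= u -> B < u -> u <= v ->
    Cmod (RInt (V := CV) f x0 v - RInt (V := CV) f x0 u) < eps).
  { intros u v H0 Hu Huv.
    assert (E : (RInt (V := CV) f x0 v - RInt (V := CV) f x0 u)%C = RInt (V := CV) f u v).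
    { assert (H1 := is_RInt_Chasles (V := CN) f x0 u v _ _ (HI x0 u ltac:(lra) H0) (HI u v H0 Huv)).
      rewrite (is_RInt_C_unique _ _ _ _ _ (HI x0 v ltac:(lra) ltac:(lra)) H1).
      unfold plus; simpl; unfold prod_plus; 
      change (RInt (V := CV) f x0 u + RInt (V := CV) f u v - RInt (V := CV) f x0 u = RInt (V := CV) f u v)%C; ring. }
    rewrite E.
    assert (H1 := Cmod_RInt_exp_le f k M u v _ Hk Huv ltac:(intros; apply Hb; lra) (HI u v H0 Huv)).
    specialize (HB u Hu).
    unfold ball in HB; simpl in HB; unfold AbsRing_ball, abs, minus, plus, opp in HB; simpl in HB.
    rewrite Ropp_0, Rplus_0_r, Rabs_pos_eq in HB by (left; apply exp_pos).
    assert (H2 := exp_pos (- k * v)).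
    assert (H3 : 0 <= M / k) by (apply Rle_mult_inv_pos; auto).
    apply Rle_lt_trans with (1 := H1).
    apply Rle_lt_trans with (M / k * exp (- k * u)); [nra|].
    apply Rle_lt_trans with (M / k * (eps / (M / k + 1))); [nra|].
    replace (M / k * (eps / (M / k + 1))) with (eps - eps / (M / k + 1)) by (field; split; lra).
    lra. }
  exists (fun b => x0 <= b /\ B < b); split.
  + apply filter_and; [apply eventually_ge|now exists B].
  + intros u v [Hu1 Hu2] [Hv1 Hv2].
    apply (norm_compat1 (V := CN)).
    rewrite norm_Cmod.
    change (Cmod (RInt (V := CV) f x0 v - RInt (V := CV) f x0 u) < eps).
    destruct (Rle_dec u v) as [H|H]; [now apply key|].
    rewrite Cmod_minus_sym; apply key; lra.
- exists l; apply is_RInt_infty_intro with (2 := Hl).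
  intros b Hb'; apply HI; lra.
Qed.

Lemma Cmod_lim_le {T} (F : (T -> Prop) -> Prop) {FF : ProperFilter F} (f : T -> C) (l : C) M :
  filterlim f F (locally (T := CN) l) -> F (fun t => Cmod (f t) <= M) -> Cmod l <= M.
Proof.
intros H1 H2.
destruct (Rle_dec (Cmod l) M) as [|Hn]; auto; exfalso.
assert (He : 0 < Cmod l - M) by lra.
assert (A := H1 _ (locally_ball_norm (V := CN) l (mkposreal _ He))).
unfold filtermap in A.
destruct (filter_ex _ (filter_and _ _ A H2)) as [t [B1 B2]].
unfold ball_norm in B1; rewrite norm_Cmod in B1.
change (Cmod (f t - l) < Cmod l - M) in B1.
assert (H3 := Cmod_triangle (f t) (l - f t)).
replace (f t + (l - f t))%C with l in H3 by ring.
rewrite Cmod_minus_sym in H3. lra.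
Qed.

Lemma Cmod_RInt_infty_le f k M x0 l : 0 < k ->
  (forall x, x0 <= x -> Ccont f x) ->
  (forall x, x0 <= x -> Cmod (f x) <= M * exp (- k * x)) ->
  is_RInt_infty f x0 l -> Cmod l <= M / k * exp (- k * x0).
Proof.
intros Hk Hc Hb Hl.
assert (HM := bound_nonneg _ _ _ _ Hb).
assert (HI : forall b, x0 <= b -> is_RInt (V := CN) f x0 b (RInt (V := CV) f x0 b)).
{ intros b Hb'; apply ex_RInt_Ccont; auto; intros; apply Hc; lra. }
apply (Cmod_lim_le _ _ _ _ (is_RInt_infty_elim _ _ _ _ HI Hl)).
generalize (eventually_ge x0); apply filter_imp; intros b Hb'.
assert (H1 := Cmod_RInt_exp_le f k M x0 b _ Hk Hb' ltac:(intros; apply Hb; lra) (HI b Hb')).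
assert (H2 := exp_pos (- k * b)).
assert (H3 : 0 <= M / k) by (apply Rle_mult_inv_pos; auto). nra.
Qed.

Lemma is_RInt_infty_comp f (g dg : R -> R) x0 l :
  (forall x, x0 <= x -> is_derive g x (dg x)) ->
  (forall x, x0 <= x -> continuous dg x) ->
  (forall x, x0 <= x -> g x0 <= g x) ->
  filterlim g (Rbar_locally p_infty) (Rbar_locally p_infty) ->
  (forall x, g x0 <= x -> Ccont f x) ->
  is_RInt_infty f (g x0) l ->
  is_RInt_infty (fun x => RtoC (dg x) * f (g x))%C x0 l.
Proof.
intros Hg Hdg Hmono Hlim Hc Hl.
assert (HI : forall b, g x0 <= b -> is_RInt (V := CN) f (g x0) b (RInt (V := CV) f (g x0) b)).
{ intros b Hb; apply ex_RInt_Ccont; auto; intros; apply Hc; lra. }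
apply is_RInt_infty_intro with (fun b => RInt (V := CV) f (g x0) (g b)).
- intros b Hb.
  apply (is_RInt_ext (V := CN) (fun x => scal (dg x) (f (g x)))).
  { intros x _. unfold scal; simpl; unfold prod_scal, Cmult, RtoC; simpl.
    unfold scal; simpl; unfold mult; simpl; f_equal; ring. }
  apply (is_RInt_comp (V := CV)); rewrite Rmin_left, Rmax_right by auto.
  + intros x Hx; apply Hc, Hmono; lra.
  + intros x Hx; split; [apply Hg | apply Hdg]; lra.
- apply filterlim_comp with (1 := Hlim).
  now apply (is_RInt_infty_elim f (g x0)).
Qed.

Lemma is_RInt_infty_derive f df x0 :
  (forall x, x0 <= x -> is_Cderive f x (df x)) ->
  (forall x, x0 <= x -> Ccont df x) ->
  filterlim f (Rbar_locally p_infty) (locally (T := CN) (RtoC 0)) ->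
  is_RInt_infty df x0 (- f x0)%C.
Proof.
intros Hd Hc Hl.
apply is_RInt_infty_intro with (fun b => f b - f x0)%C.
- intros b Hb; apply is_RInt_Cderive; auto; intros; [apply Hd | apply Hc]; lra.
- assert (H := filterlim_plus (V := CN) (RtoC 0) (- f x0)%C).
  assert (H1 := filterlim_comp_2 (H := locally (T := CN) (- f x0)%C) _ _ (plus (G := CN)) Hl (filterlim_const _) H).
  replace (- f x0)%C with (plus (RtoC 0 : CN) (- f x0)%C : C).
  2: { change (RtoC 0 + (- f x0) = - f x0)%C; ring. }
  exact H1.
Qed.

(** * Complex differentiability and Cauchy's theorem on a rectangle *)

(** Joint continuity in the two real coordinates, in the form in which
    differentiation under the integral sign requires it. *)
Definition Ccont2 (g : C -> C) (w : C) : Prop :=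
  continuity_2d_pt (fun u v => Re (g (u, v))) (Re w) (Im w) /\
  continuity_2d_pt (fun u v => Im (g (u, v))) (Re w) (Im w).

Lemma Ccont2_const c w : Ccont2 (fun _ => c) w.
Proof. split; apply continuity_2d_pt_const. Qed.

Lemma Ccont2_id w : Ccont2 (fun v => v) w.
Proof. split; [apply continuity_2d_pt_id1 | apply continuity_2d_pt_id2]. Qed.

Lemma Ccont2_plus f g w : Ccont2 f w -> Ccont2 g w -> Ccont2 (fun v => f v + g v)%C w.
Proof. intros [H1 H2] [H3 H4]; split; simpl; apply continuity_2d_pt_plus; auto. Qed.

Lemma Ccont2_opp f w : Ccont2 f w -> Ccont2 (fun v => - f v)%C w.
Proof. intros [H1 H2]; split; simpl; apply continuity_2d_pt_opp; auto. Qed.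

Lemma Ccont2_minus f g w : Ccont2 f w -> Ccont2 g w -> Ccont2 (fun v => f v - g v)%C w.
Proof. intros; apply Ccont2_plus; auto; now apply Ccont2_opp. Qed.

Lemma Ccont2_mult f g w : Ccont2 f w -> Ccont2 g w -> Ccont2 (fun v => f v * g v)%C w.
Proof.
intros [H1 H2] [H3 H4]; split; simpl;
  [apply continuity_2d_pt_minus | apply continuity_2d_pt_plus];
  apply continuity_2d_pt_mult; auto.
Qed.

Lemma Ccont2_inv f w : Ccont2 f w -> f w <> RtoC 0 -> Ccont2 (fun v => / f v)%C w.
Proof.
intros [H1 H2] H0; apply Csqr_pos in H0.
rewrite (surjective_pairing w) in H0.
assert (H : continuity_2d_pt (fun u v => / (Re (f (u, v)) ^ 2 + Im (f (u, v)) ^ 2)) (Re w) (Im w)).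
{ apply (continuity_2d_pt_inv (fun u v => Re (f (u, v)) ^ 2 + Im (f (u, v)) ^ 2)); auto.
  simpl; apply continuity_2d_pt_plus; repeat apply continuity_2d_pt_mult;
   auto; apply continuity_2d_pt_const. }
split; simpl; apply (continuity_2d_pt_mult); auto.
now apply (continuity_2d_pt_opp (fun u v => Im (f (u, v)))).
Qed.

Lemma Ccont2_Cexp f w : Ccont2 f w -> Ccont2 (fun v => Cexp (f v)) w.
Proof.
intros [H1 H2]; split; simpl; apply continuity_2d_pt_mult;
  (apply continuity_1d_2d_pt_comp; [|assumption]).
- apply derivable_continuous_pt, derivable_pt_exp.
- apply continuity_cos.
- apply derivable_continuous_pt, derivable_pt_exp.
- apply continuity_sin.
Qed.

Lemma continuity_2d_pt_slice f (g1 g2 : R -> R) x y t :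
  continuity_2d_pt f x y -> continuous g1 t -> continuous g2 t -> g1 t = x -> g2 t = y ->
  continuous (fun u => f (g1 u) (g2 u)) t.
Proof.
intros H H1 H2 E1 E2; subst x y.
apply continuity_2d_pt_filterlim in H.
apply (filterlim_comp _ _ _ (fun u => (g1 u, g2 u)) (fun z => f (fst z) (snd z)) _ (locally (g1 t, g2 t))); auto.
intros P [eps HP].
assert (A1 := H1 _ (locally_ball _ eps)).
assert (A2 := H2 _ (locally_ball _ eps)).
unfold filtermap in *.
generalize (filter_and _ _ A1 A2); apply filter_imp.
intros u [B1 B2]; apply HP; split; assumption.
Qed.

Lemma Ccont2_x g w : Ccont2 g w -> Ccont (fun t => g (t, Im w)) (Re w).
Proof.
intros [H1 H2]; apply filterlim_C; [typeclasses eauto|..].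
- apply (continuity_2d_pt_slice (fun u v => Re (g (u, v))) (fun u => u) (fun _ => Im w) (Re w) (Im w) (Re w)); auto;
   [apply continuous_id | apply continuous_const].
- apply (continuity_2d_pt_slice (fun u v => Im (g (u, v))) (fun u => u) (fun _ => Im w) (Re w) (Im w) (Re w)); auto;
   [apply continuous_id | apply continuous_const].
Qed.

Lemma Ccont2_y g w : Ccont2 g w -> Ccont (fun t => g (Re w, t)) (Im w).
Proof.
intros [H1 H2]; apply filterlim_C; [typeclasses eauto|..].
- apply (continuity_2d_pt_slice (fun u v => Re (g (u, v))) (fun _ => Re w) (fun u => u) (Re w) (Im w) (Im w)); auto;
   [apply continuous_const | apply continuous_id].
- apply (continuity_2d_pt_slice (fun u v => Im (g (u, v))) (fun _ => Re w) (fun u => u) (Re w) (Im w) (Im w)); auto;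
   [apply continuous_const | apply continuous_id].
Qed.

(** The Cauchy-Riemann equations: the partial derivatives at [w] are [d] along the
    real axis and [Ci * d] along the imaginary axis. *)
Definition has_Cderive (g : C -> C) (w d : C) : Prop :=
  is_Cderive (fun t => g (t, Im w)) (Re w) d /\
  is_Cderive (fun t => g (Re w, t)) (Im w) (Ci * d)%C.

Lemma has_Cderive_eq f w d d' : has_Cderive f w d -> d = d' -> has_Cderive f w d'.
Proof. now intros H <-. Qed.
Lemma has_Cderive_const c w : has_Cderive (fun _ => c) w (RtoC 0).
Proof.
split; eapply is_Cderive_eq; try apply is_Cderive_const; ring.
Qed.
Lemma has_Cderive_id w : has_Cderive (fun v => v) w (RtoC 1).
Proof.
split; eapply is_Cderive_eq; [apply is_Cderive_re | reflexivity | apply is_Cderive_im | ring].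
Qed.
Lemma has_Cderive_minus f g w df dg : has_Cderive f w df -> has_Cderive g w dg ->
  has_Cderive (fun v => f v - g v)%C w (df - dg)%C.
Proof.
intros [H1 H2] [H3 H4]; split; eapply is_Cderive_eq; try (apply is_Cderive_minus; eassumption); ring.
Qed.
Lemma Cpair_eta (w : C) : (Re w, Im w) = w.
Proof. now destruct w. Qed.
Lemma has_Cderive_mult f g w df dg : has_Cderive f w df -> has_Cderive g w dg ->
  has_Cderive (fun v => f v * g v)%C w (df * g w + f w * dg)%C.
Proof.
intros [H1 H2] [H3 H4]; split; eapply is_Cderive_eq; try (apply is_Cderive_mult; eassumption);
 cbv beta; rewrite Cpair_eta; ring.
Qed.
Lemma has_Cderive_Cexp f w df : has_Cderive f w df ->
  has_Cderive (fun v => Cexp (f v)) w (df * Cexp (f w))%C.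
Proof.
intros [H1 H2]; split; eapply is_Cderive_eq; try (apply is_Cderive_Cexp; eassumption);
 cbv beta; rewrite Cpair_eta; ring.
Qed.
Lemma has_Cderive_inv f w df : has_Cderive f w df -> f w <> RtoC 0 ->
  has_Cderive (fun v => / f v)%C w (- df * / f w * / f w)%C.
Proof.
intros [H1 H2] H0; split; (eapply is_Cderive_eq;
 [apply is_Cderive_inv; [eassumption | cbv beta; now rewrite Cpair_eta]|]);
 cbv beta; rewrite Cpair_eta; ring.
Qed.

Lemma is_RInt_RInt_C f a b l : is_RInt (V := CN) f a b l ->
  RInt (fun t => Re (f t)) a b = Re l /\ RInt (fun t => Im (f t)) a b = Im l.
Proof.
intros H; split; apply is_RInt_unique; [now apply is_RInt_C_Re | now apply is_RInt_C_Im].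
Qed.

Lemma is_Cderive_RInt (g g' : C -> C) a b x1 x2 x : a <= b -> x1 < x < x2 ->
  (forall w, x1 < Re w < x2 -> has_Cderive g w (g' w)) ->
  (forall w, x1 < Re w < x2 -> Ccont2 g' w) ->
  is_Cderive (fun u => RInt (V := CV) (fun y => g (u, y)) a b) x
    (RInt (V := CV) (fun y => g' (x, y)) a b).
Proof.
intros Hab Hx Hd Hc.
assert (Hloc : locally x (fun u => x1 < u < x2)).
{ apply (open_and (fun u => x1 < u) (fun u => u < x2)); auto; [apply open_gt | apply open_lt]. }
assert (Hcg : forall u, x1 < u < x2 -> is_RInt (V := CN) (fun y => g (u, y)) a b (RInt (V := CV) (fun y => g (u, y)) a b)).
{ intros u Hu; apply ex_RInt_Ccont; auto; intros y _.
  eapply is_Cderive_continuous, (Hd (u, y)); auto. }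
assert (Hcg' : is_RInt (V := CN) (fun y => g' (x, y)) a b (RInt (V := CV) (fun y => g' (x, y)) a b)).
{ apply ex_RInt_Ccont; auto; intros y _; apply (Ccont2_y g' (x, y)); auto. }
destruct (is_RInt_RInt_C _ _ _ _ Hcg') as [R1 R2].
assert (main : forall p : C -> R,
  (forall w, x1 < Re w < x2 -> is_derive (fun t => p (g (t, Im w))) (Re w) (p (g' w))) ->
  (forall w, x1 < Re w < x2 -> continuity_2d_pt (fun u v => p (g' (u, v))) (Re w) (Im w)) ->
  (forall u, x1 < u < x2 -> ex_RInt (fun y => p (g (u, y))) a b) ->
  is_derive (fun u => RInt (fun y => p (g (u, y))) a b) x (RInt (fun y => p (g' (x, y))) a b)).
{ intros p Hp1 Hp2 Hp3.
  assert (E : RInt (fun y => p (g' (x, y))) a b = RInt (fun t => Derive (fun u => p (g (u, t))) x) a b).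
  { apply RInt_ext; intros y _; symmetry; apply is_derive_unique, (Hp1 (x, y)); auto. }
  rewrite E.
  apply (is_derive_RInt_param (fun u y => p (g (u, y)))).
  - revert Hloc; apply filter_imp; intros u Hu t _; eexists; apply (Hp1 (u, t)); auto.
  - intros t _; apply continuity_2d_pt_ext_loc with (fun u v => p (g' (u, v))).
    + destruct Hloc as [d Hd']; exists d; intros u v Hu _.
      symmetry; apply is_derive_unique, (Hp1 (u, v)); simpl; apply Hd'; exact Hu.
    + apply (Hp2 (x, t)); auto.
  - revert Hloc; apply filter_imp; intros u Hu; apply Hp3; auto. }
split.
- rewrite <- R1.
  eapply is_derive_ext_loc; [|apply main; [| |]].
  + revert Hloc; apply filter_imp; intros u Hu; apply (is_RInt_RInt_C _ _ _ _ (Hcg u Hu)).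
  + intros w Hw; apply (Hd w Hw).
  + intros w Hw; apply (Hc w Hw).
  + intros u Hu; eexists; apply is_RInt_C_Re, Hcg; auto.
- rewrite <- R2.
  eapply is_derive_ext_loc; [|apply main; [| |]].
  + revert Hloc; apply filter_imp; intros u Hu; apply (is_RInt_RInt_C _ _ _ _ (Hcg u Hu)).
  + intros w Hw; apply (Hd w Hw).
  + intros w Hw; apply (Hc w Hw).
  + intros u Hu; eexists; apply is_RInt_C_Im, Hcg; auto.
Qed.

(** The function x |-> i * (integral of g (x, .) over [a, b]) has derivative
    i * (integral of g' (x, .)); as i g' is the y-derivative of g, this is
    g (x, b) - g (x, a). *)
Lemma Cauchy_rectangle (g g' : C -> C) a b x0 x1 x2 x3 l1 l2 : a <= b ->
  x0 < x1 -> x1 <= x2 -> x2 < x3 ->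
  (forall w, x0 < Re w < x3 -> has_Cderive g w (g' w)) ->
  (forall w, x0 < Re w < x3 -> Ccont2 g' w) ->
  is_RInt (V := CN) (fun y => g (x1, y)) a b l1 ->
  is_RInt (V := CN) (fun y => g (x2, y)) a b l2 ->
  is_RInt (V := CN) (fun x => g (x, b) - g (x, a))%C x1 x2 (Ci * l2 - Ci * l1)%C.
Proof.
intros Hab H01 H12 H23 Hd Hc Hl1 Hl2.
rewrite <- (is_RInt_unique (V := CV) _ _ _ _ Hl1), <- (is_RInt_unique (V := CV) _ _ _ _ Hl2).
apply (is_RInt_Cderive (fun u => Ci * RInt (V := CV) (fun y => g (u, y)) a b)%C); auto.
- intros x Hx.
  eapply is_Cderive_eq.
  + apply is_Cderive_mult; [apply is_Cderive_const|].
    apply (is_Cderive_RInt g g' a b x0 x3); auto; lra.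
  + assert (Hcg' : is_RInt (V := CN) (fun y => g' (x, y)) a b (RInt (V := CV) (fun y => g' (x, y)) a b)).
    { apply ex_RInt_Ccont; auto; intros y _; apply (Ccont2_y g' (x, y)), Hc; simpl; lra. }
    rewrite (is_RInt_C_unique (fun y => Ci * g' (x, y))%C a b (g (x, b) - g (x, a))%C
      (Ci * (RInt (V := CV) (fun y => g' (x, y)) a b))%C); [ring| |].
    * apply (is_RInt_Cderive (fun y => g (x, y))); auto.
      -- intros y _; apply (Hd (x, y)); simpl; lra.
      -- intros y _; apply (Ccont2_y (fun w => Ci * g' w)%C (x, y)), Ccont2_mult; [apply Ccont2_const|].
         apply Hc; simpl; lra.
    * now apply is_RInt_Cmult_const.
- intros x Hx. eapply is_Cderive_continuous, is_Cderive_minus;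
  [apply (Hd (x, b)) | apply (Hd (x, a))]; simpl; lra.
Qed.

(** * Integration along the boundary of a half-strip *)

(** Under u = e^w, the boundary of the half-strip Re w >= x0, a <= Im w <= b is the
    Hankel contour made of the rays of arguments [a] and [b] and of the arc of
    radius e^x0 that joins them. *)
Definition on_half_strip (a b x0 : R) (w : C) : Prop :=
  (x0 <= Re w /\ (Im w = a \/ Im w = b)) \/ (Re w = x0 /\ a <= Im w <= b).

(** The contour comes from +oo along Im w = a, follows the segment Re w = x0 upwards
    and returns to +oo along Im w = b. *)
Definition is_half_strip_int (a b : R) (g : C -> C) (x0 : R) (l : C) : Prop :=
  exists l1 l2 l3,
    is_RInt_infty (fun x => g (x, a)) x0 l1 /\
    is_RInt (V := CN) (fun y => g (x0, y)) a b l2 /\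
    is_RInt_infty (fun x => g (x, b)) x0 l3 /\
    l = (l3 - l1 + Ci * l2)%C.

Section Strip.
Variables (a b : R).
Hypothesis Hab : a <= b.

Lemma on_half_strip_a x0 x : x0 <= x -> on_half_strip a b x0 (x, a).
Proof. left; simpl; auto. Qed.
Lemma on_half_strip_b x0 x : x0 <= x -> on_half_strip a b x0 (x, b).
Proof. left; simpl; auto. Qed.
Lemma on_half_strip_arc x0 y : a <= y <= b -> on_half_strip a b x0 (x0, y).
Proof. right; simpl; auto. Qed.
Local Hint Resolve on_half_strip_a on_half_strip_b on_half_strip_arc : core.

Lemma is_half_strip_int_unique g x0 l l' : is_half_strip_int a b g x0 l -> is_half_strip_int a b g x0 l' -> l = l'.
Proof.
intros (l1 & l2 & l3 & H1 & H2 & H3 & ->) (m1 & m2 & m3 & H1' & H2' & H3' & ->).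
now rewrite (is_RInt_infty_unique _ _ _ _ H1 H1'), (is_RInt_infty_unique _ _ _ _ H3 H3'),
  (is_RInt_C_unique _ _ _ _ _ H2 H2').
Qed.

Lemma is_half_strip_int_ext f g x0 l : (forall w, on_half_strip a b x0 w -> f w = g w) ->
  is_half_strip_int a b f x0 l -> is_half_strip_int a b g x0 l.
Proof.
intros E (l1 & l2 & l3 & H1 & H2 & H3 & ->).
exists l1, l2, l3; repeat split.
- apply is_RInt_infty_ext with (2 := H1); intros; apply E; apply on_half_strip_a; lra.
- apply (is_RInt_ext (V := CN)) with (2 := H2); rewrite Rmin_left, Rmax_right by auto; intros y Hy; apply E, on_half_strip_arc; lra.
- apply is_RInt_infty_ext with (2 := H3); intros; apply E, on_half_strip_b; lra.
Qed.

Lemma is_half_strip_int_plus f g x0 lf lg : is_half_strip_int a b f x0 lf -> is_half_strip_int a b g x0 lg ->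
  is_half_strip_int a b (fun w => f w + g w)%C x0 (lf + lg)%C.
Proof.
intros (l1 & l2 & l3 & H1 & H2 & H3 & ->) (m1 & m2 & m3 & H1' & H2' & H3' & ->).
exists (l1 + m1)%C, (l2 + m2)%C, (l3 + m3)%C; repeat split.
- now apply is_RInt_infty_plus.
- exact (is_RInt_plus (V := CN) _ _ _ _ _ _ H2 H2').
- now apply is_RInt_infty_plus.
- ring.
Qed.

Lemma is_half_strip_int_mult c f x0 l : is_half_strip_int a b f x0 l ->
  is_half_strip_int a b (fun w => c * f w)%C x0 (c * l)%C.
Proof.
intros (l1 & l2 & l3 & H1 & H2 & H3 & ->).
exists (c * l1)%C, (c * l2)%C, (c * l3)%C; repeat split.
- now apply is_RInt_infty_mult.
- now apply is_RInt_Cmult_const.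
- now apply is_RInt_infty_mult.
- ring.
Qed.

Lemma is_half_strip_int_minus f g x0 lf lg : is_half_strip_int a b f x0 lf -> is_half_strip_int a b g x0 lg ->
  is_half_strip_int a b (fun w => f w - g w)%C x0 (lf - lg)%C.
Proof.
intros H1 H2.
replace (lf - lg)%C with (lf + (RtoC (-1)) * lg)%C
  by (unfold RtoC, Cminus, Cplus, Cmult, Copp; simpl; f_equal; ring).
apply is_half_strip_int_ext with (fun w => f w + RtoC (-1) * g w)%C.
- intros; unfold RtoC, Cminus, Cplus, Cmult, Copp; simpl; f_equal; ring.
- apply is_half_strip_int_plus; auto; now apply is_half_strip_int_mult.
Qed.

Lemma ex_half_strip_int g x0 k M : 0 < k ->
  (forall w, on_half_strip a b x0 w -> Ccont2 g w) ->
  (forall w, x0 <= Re w -> Im w = a \/ Im w = b -> Cmod (g w) <= M * exp (- k * Re w)) ->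
  exists l, is_half_strip_int a b g x0 l.
Proof.
intros Hk Hc Hb.
destruct (ex_RInt_infty (fun x => g (x, a)) k M x0) as [l1 H1]; [exact Hk| | |].
{ intros x Hx; apply (Ccont2_x g (x, a)), Hc; auto. }
{ intros x Hx; apply (Hb (x, a)); auto. }
destruct (ex_RInt_infty (fun x => g (x, b)) k M x0) as [l3 H3]; [exact Hk| | |].
{ intros x Hx; apply (Ccont2_x g (x, b)), Hc; auto. }
{ intros x Hx; apply (Hb (x, b)); auto. }
exists (l3 - l1 + Ci * (RInt (V := CV) (fun y => g (x0, y)) a b))%C.
exists l1, (RInt (V := CV) (fun y => g (x0, y)) a b), l3; repeat split; auto.
apply ex_RInt_Ccont; auto; intros y Hy; apply (Ccont2_y g (x0, y)), Hc; auto.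
Qed.

Lemma Cmod_half_strip_int_le g x0 k M l : 0 < k ->
  (forall w, on_half_strip a b x0 w -> Ccont2 g w) ->
  (forall w, on_half_strip a b x0 w -> Cmod (g w) <= M * exp (- k * Re w)) ->
  is_half_strip_int a b g x0 l ->
  Cmod l <= (2 / k + (b - a)) * (M * exp (- k * x0)).
Proof.
intros Hk Hc Hb (l1 & l2 & l3 & H1 & H2 & H3 & ->).
assert (B1 : Cmod l1 <= M / k * exp (- k * x0)).
{ apply (Cmod_RInt_infty_le (fun x => g (x, a))); [exact Hk| | |exact H1]; intros x Hx.
  - apply (Ccont2_x g (x, a)), Hc; auto.
  - apply (Hb (x, a)); auto. }
assert (B3 : Cmod l3 <= M / k * exp (- k * x0)).
{ apply (Cmod_RInt_infty_le (fun x => g (x, b))); [exact Hk| | |exact H3]; intros x Hx.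
  - apply (Ccont2_x g (x, b)), Hc; auto.
  - apply (Hb (x, b)); auto. }
assert (B2 : Cmod l2 <= (b - a) * (M * exp (- k * x0))).
{ apply (Cmod_RInt_le (fun y => g (x0, y)) (fun _ => M * exp (- k * x0)) a b); [exact Hab| |exact H2|].
  - intros y Hy; apply (Hb (x0, y)); auto.
  - apply (is_RInt_const a b (M * exp (- k * x0))). }
eapply Rle_trans; [apply Cmod_triangle|]; rewrite Cmod_mult, Cmod_Ci.
assert (H4 := Cmod_triangle l3 (- l1)); rewrite Cmod_opp in H4.
replace ((2 / k + (b - a)) * (M * exp (- k * x0)))
  with (M / k * exp (- k * x0) + M / k * exp (- k * x0) + (b - a) * (M * exp (- k * x0)))
  by (field; lra).
unfold Cminus; lra.
Qed.

(** The increments of the primitive over the three sides telescope, and it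
    vanishes at both ends of the contour. *)
Lemma is_half_strip_int_exact f df x0 :
  (forall w, on_half_strip a b x0 w -> has_Cderive f w (df w)) ->
  (forall w, on_half_strip a b x0 w -> Ccont2 df w) ->
  filterlim (fun x => f (x, a)) (Rbar_locally p_infty) (locally (T := CN) (RtoC 0)) ->
  filterlim (fun x => f (x, b)) (Rbar_locally p_infty) (locally (T := CN) (RtoC 0)) ->
  is_half_strip_int a b df x0 (RtoC 0).
Proof.
intros Hd Hc Ha Hb.
set (l2 := RInt (V := CV) (fun y => df (x0, y)) a b).
assert (H2 : is_RInt (V := CN) (fun y => df (x0, y)) a b l2).
{ apply ex_RInt_Ccont; auto; intros y Hy; apply (Ccont2_y df (x0, y)), Hc; auto. }
exists (- f (x0, a))%C, l2, (- f (x0, b))%C; repeat split; auto.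
- apply (is_RInt_infty_derive (fun x => f (x, a))); [| |exact Ha]; intros x Hx.
  + apply (Hd (x, a)); auto.
  + apply (Ccont2_x df (x, a)), Hc; auto.
- apply (is_RInt_infty_derive (fun x => f (x, b))); [| |exact Hb]; intros x Hx.
  + apply (Hd (x, b)); auto.
  + apply (Ccont2_x df (x, b)), Hc; auto.
- rewrite (is_RInt_C_unique (fun y => Ci * df (x0, y))%C a b (Ci * l2)%C (f (x0, b) - f (x0, a))%C).
  + ring.
  + now apply is_RInt_Cmult_const.
  + apply (is_RInt_Cderive (fun y => f (x0, y))); [exact Hab| |]; intros y Hy.
    * apply (Hd (x0, y)); auto.
    * apply (Ccont2_y (fun w => Ci * df w)%C (x0, y)), Ccont2_mult; [apply Ccont2_const|apply Hc; auto].
Qed.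

(** The two contours differ by the boundary of a rectangle, so Cauchy's theorem
    applies. *)
Lemma is_half_strip_int_move g g' x0 x1 x2 x3 l : x0 < x1 -> x1 <= x2 -> x2 < x3 ->
  (forall w, x0 < Re w < x3 -> has_Cderive g w (g' w)) ->
  (forall w, x0 < Re w < x3 -> Ccont2 g' w) ->
  is_half_strip_int a b g x2 l -> is_half_strip_int a b g x1 l.
Proof.
intros H01 H12 H23 Hd Hc (l1 & l2 & l3 & H1 & H2 & H3 & ->).
assert (HR : forall y, is_RInt (V := CN) (fun x => g (x, y)) x1 x2 (RInt (V := CV) (fun x => g (x, y)) x1 x2)).
{ intros y; apply ex_RInt_Ccont; auto; intros x Hx.
  eapply is_Cderive_continuous, (Hd (x, y)); simpl; lra. }
assert (HA := ex_RInt_Ccont (fun y => g (x1, y)) a b Hab).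
assert (HA' : is_RInt (V := CN) (fun y => g (x1, y)) a b (RInt (V := CV) (fun y => g (x1, y)) a b)).
{ apply HA; intros y _; eapply is_Cderive_continuous, (Hd (x1, y)); simpl; lra. }
clear HA.
assert (HC := Cauchy_rectangle g g' a b x0 x1 x2 x3 _ _ Hab H01 H12 H23 Hd Hc HA' H2).
assert (HC' := is_RInt_minus (V := CN) _ _ _ _ _ _ (HR b) (HR a)).
assert (E := is_RInt_C_unique _ _ _ _ _ HC HC').
change (minus (G := CN)) with Cminus in E.
eexists _, _, _; split; [|split; [|split]].
- apply (is_RInt_infty_Chasles (fun x => g (x, a)) x1 x2 _ _ (HR a) H1).
- exact HA'.
- apply (is_RInt_infty_Chasles (fun x => g (x, b)) x1 x2 _ _ (HR b) H3).
- set (A1 := RInt (V := CV) (fun x => g (x, a)) x1 x2) in *.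
  set (B1 := RInt (V := CV) (fun x => g (x, b)) x1 x2) in *.
  set (Y1 := RInt (V := CV) (fun y => g (x1, y)) a b) in *.
  replace (B1 + l3 - (A1 + l1) + Ci * Y1)%C with ((B1 - A1) + (l3 - l1) + Ci * Y1)%C by ring.
  change (B1 - A1)%C with (Cminus B1 A1). rewrite <- E. ring.
Qed.

Lemma is_half_strip_int_shift g x0 tau l :
  (forall w, on_half_strip a b (x0 + tau) w -> Ccont2 g w) ->
  is_half_strip_int a b g (x0 + tau) l -> is_half_strip_int a b (fun w => g (w + RtoC tau)%C) x0 l.
Proof.
intros Hc (l1 & l2 & l3 & H1 & H2 & H3 & ->).
assert (S : forall x y, ((x, y) + RtoC tau)%C = (x + tau, y)).
{ intros; unfold Cplus, RtoC; simpl; f_equal; ring. }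
assert (HT : forall y m, y = a \/ y = b -> is_RInt_infty (fun x => g (x, y)) (x0 + tau) m ->
  is_RInt_infty (fun x => g ((x, y) + RtoC tau)%C) x0 m).
{ intros y m Hy Hm.
  apply is_RInt_infty_ext with (fun x => RtoC 1 * g ((x + tau)%R, y))%C.
  { intros x _; now rewrite S, Cmult_1_l. }
  apply (is_RInt_infty_comp (fun x => g (x, y)) (fun x => x + tau) (fun _ => 1)); auto.
  - intros; auto_derive; auto.
  - intros; apply continuous_const.
  - intros; lra.
  - intros P [B HB]; exists (B - tau); intros; apply HB; lra.
  - intros x Hx; apply (Ccont2_x g (x, y)), Hc; left; auto. }
exists l1, l2, l3; repeat split; auto.
apply (is_RInt_ext (V := CN)) with (2 := H2); intros; now rewrite S.
Qed.
End Strip.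

(** * The residue of u^(-s) / (u - 1) at u = 1 *)

Lemma Cmod_sqr (c : C) : Cmod c * Cmod c = Re c * Re c + Im c * Im c.
Proof. assert (H := Cmod2_alt c); simpl in H; rewrite !Rmult_1_r in H; exact H. Qed.

Lemma Rabs_le_of_sqr x m : 0 <= m -> x * x <= m * m -> Rabs x <= m.
Proof. intros Hm H; apply Rsqr_le_abs_0 in H; now rewrite (Rabs_pos_eq m) in H. Qed.

Lemma Cmod_Cexp_sub_1_sqr w :
  Cmod (Cexp w - 1) * Cmod (Cexp w - 1)
  = (exp (Re w) - 1) * (exp (Re w) - 1) + 2 * exp (Re w) * (1 - cos (Im w)).
Proof.
rewrite Cmod_sqr; unfold Cexp; simpl.
assert (H := sin2_cos2 (Im w)); unfold Rsqr in H.
transitivity (exp (Re w) * exp (Re w) * (sin (Im w) * sin (Im w) + cos (Im w) * cos (Im w))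
  - 2 * exp (Re w) * cos (Im w) + 1); [ring|].
rewrite H; ring.
Qed.

Lemma Cmod_Cexp_sub_1_radial w : Rabs (exp (Re w) - 1) <= Cmod (Cexp w - 1).
Proof.
apply Rabs_le_of_sqr; [apply Cmod_ge_0|].
rewrite Cmod_Cexp_sub_1_sqr.
assert (H := COS_bound (Im w)); assert (H1 := exp_pos (Re w)); nra.
Qed.

Lemma Cmod_Cexp_sub_1_left w : cos (Im w) <= 0 -> exp (Re w) <= Cmod (Cexp w - 1) /\ 1 <= Cmod (Cexp w - 1).
Proof.
intros Hc; assert (E := Cmod_Cexp_sub_1_sqr w).
assert (H1 := exp_pos (Re w)); assert (H2 := Cmod_ge_0 (Cexp w - 1)).
split; (apply Rsqr_incr_0; [unfold Rsqr; nra|lra|lra]).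
Qed.

(** Meant for t = |y| / 2 with |y| <= 3 PI / 2, to bound 1 - cos y from below by a
    multiple of y^2. *)
Lemma sin_lower_bound t : 0 <= t <= 5 * (PI / 6) -> t / 8 <= sin t.
Proof.
intros Ht.
assert (HP := PI_RGT_0). assert (HP4 := PI_4).
assert (S6 : sin (PI / 6) = 1 / 2) by apply sin_PI6.
destruct (Rle_dec t (PI / 6)) as [H|H].
- assert (Hc : forall x, 0 <= x <= PI / 6 -> 1 / 8 <= cos x).
  { intros x Hx.
    assert (cos (PI / 3) <= cos x) by (apply cos_decr_1; lra).
    rewrite cos_PI3 in H0. lra. }
  assert (mvt := MVT_gen sin 0 t cos).
  cbv zeta in mvt; rewrite Rmin_left, Rmax_right in mvt by lra.
  destruct mvt as [x [Hx E]].
  + intros; apply is_derive_sin.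
  + intros; apply continuity_sin.
  + rewrite sin_0 in E. specialize (Hc x ltac:(lra)). nra.
- apply Rle_trans with (1 / 2); [lra|].
  rewrite <- S6. destruct (Rle_dec t (PI / 2)).
  + apply sin_incr_1; lra.
  + rewrite <- (sin_PI_x t). apply sin_incr_1; lra.
Qed.

Lemma exp_sub_1_lower x : -1 <= x -> Rabs x <= 3 * Rabs (exp x - 1).
Proof.
intros Hx. assert (H1 := exp_ineq1_le x).
destruct (Rle_dec 0 x).
- rewrite !Rabs_pos_eq by lra. lra.
- rewrite (Rabs_left x) by lra.
  assert (E : exp x * exp (- x) = 1) by (rewrite <- exp_plus, Rplus_opp_r; apply exp_0).
  assert (H2 := exp_ineq1_le (- x)).
  assert (H3 := exp_pos x).
  assert (H4 : exp x <= 1) by (apply exp_le_1; lra).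
  assert (H5 : exp (- x) <= 3).
  { eapply Rle_trans; [|apply exp_le_3]; apply exp_le_mono; lra. }
  rewrite Rabs_left1 by lra. nra.
Qed.

(** In this rectangle e^w - 1 has the only zero w = 0, which is simple. The constant
    comes from |Re w| <= 3 |e^(Re w) - 1| and |Im w| <= 16 |e^w - 1|. *)
Lemma Cmod_le_Cexp_sub_1 w : -1 <= Re w <= 1 -> Rabs (Im w) <= 3 * (PI / 2) ->
  Cmod w <= 20 * Cmod (Cexp w - 1).
Proof.
intros Hx Hy.
assert (H1 := Cmod_Cexp_sub_1_radial w).
assert (H2 := exp_sub_1_lower (Re w) ltac:(lra)).
assert (H3 : Rabs (Im w) <= 16 * Cmod (Cexp w - 1)).
{ assert (Hs : Rabs (Im w) / 2 / 8 <= sin (Rabs (Im w) / 2)).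
  { apply sin_lower_bound; assert (H := Rabs_pos (Im w)); lra. }
  assert (Hc : 1 - cos (Im w) = 2 * (sin (Rabs (Im w) / 2) * sin (Rabs (Im w) / 2))).
  { replace (cos (Im w)) with (cos (Rabs (Im w))).
    - replace (Rabs (Im w)) with (2 * (Rabs (Im w) / 2)) at 1 by field.
      rewrite cos_2a_sin; ring.
    - unfold Rabs; destruct Rcase_abs; auto; apply cos_neg. }
  assert (E := Cmod_Cexp_sub_1_sqr w). rewrite Hc in E.
  assert (He : 1 / 3 <= exp (Re w)).
  { assert (H4 : exp (- Re w) <= 3).
    { eapply Rle_trans; [|apply exp_le_3]; apply exp_le_mono; lra. }
    assert (E1 : exp (Re w) * exp (- Re w) = 1) by (rewrite <- exp_plus, Rplus_opp_r; apply exp_0).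
    assert (H5 := exp_pos (Re w)). nra. }
  set (r := Rabs (Im w)) in *. set (sn := sin (r / 2)) in *.
  assert (Hr : 0 <= r) by apply Rabs_pos.
  apply Rsqr_incr_0; [|auto| assert (H := Cmod_ge_0 (Cexp w - 1)); lra].
  unfold Rsqr.
  assert (r * r <= 256 * (sn * sn)) by nra.
  replace (16 * Cmod (Cexp w - 1) * (16 * Cmod (Cexp w - 1)))
    with (256 * (Cmod (Cexp w - 1) * Cmod (Cexp w - 1))) by ring.
  rewrite E.
  assert (0 <= (exp (Re w) - 1) * (exp (Re w) - 1)) by apply Rle_0_sqr.
  assert (sn * sn <= 2 * exp (Re w) * (2 * (sn * sn))) by (assert (0 <= sn * sn) by apply Rle_0_sqr; nra).
  lra. }
eapply Rle_trans; [apply Cmod_le_sum|]. assert (H4 := Cmod_ge_0 (Cexp w - 1)); lra.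
Qed.

(** The power u^(1 - s) for u = e^w, with Im w as the argument of u. Since
    du = u dw, it is also what u^(-s) du becomes. *)
Definition upow (s w : C) : C := Cexp (w * (1 - s)).

Lemma Cmod_upow s w : Cmod (upow s w) = exp ((1 - Re s) * Re w + Im s * Im w).
Proof. unfold upow; rewrite Cmod_Cexp; f_equal; unfold Re, Im; simpl; ring. Qed.

(** The bound of exp (Im s * Im w) on the contours used here, where
    |Im w| <= 3 PI / 2 < 8. *)
Definition upow_bound (s : C) : R := exp (8 * Rabs (Im s)).

Lemma Cmod_upow_le s w : Rabs (Im w) <= 3 * (PI / 2) ->
  Cmod (upow s w) <= upow_bound s * exp ((1 - Re s) * Re w).
Proof.
intros H; rewrite Cmod_upow; unfold upow_bound; rewrite <- exp_plus.
apply exp_le_mono.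
assert (H1 := Rle_abs (Im s * Im w)); rewrite Rabs_mult in H1.
assert (H2 := Rabs_pos (Im s)). assert (H4 := PI_4).
assert (H5 : Rabs (Im s) * Rabs (Im w) <= Rabs (Im s) * 8) by (apply Rmult_le_compat_l; lra).
lra.
Qed.

Lemma Ccont2_upow s w : Ccont2 (upow s) w.
Proof. apply Ccont2_Cexp, Ccont2_mult; [apply Ccont2_id|apply Ccont2_const]. Qed.

Lemma has_Cderive_upow s w : has_Cderive (upow s) w ((1 - s) * upow s w)%C.
Proof.
eapply has_Cderive_eq.
- apply has_Cderive_Cexp, has_Cderive_mult; [apply has_Cderive_id | apply has_Cderive_const].
- unfold upow; ring.
Qed.

(** What u^(-s) / (u - 1) du becomes under u = e^w. *)
Definition pole_kernel (s w : C) : C := (upow s w * / (Cexp w - 1))%C.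

Definition pole_kernel_deriv (s w : C) : C :=
  ((1 - s) * upow s w * / (Cexp w - 1)
   + upow s w * (- Cexp w * / (Cexp w - 1) * / (Cexp w - 1)))%C.

Lemma has_Cderive_pole_kernel s w : (Cexp w - 1)%C <> RtoC 0 ->
  has_Cderive (pole_kernel s) w (pole_kernel_deriv s w).
Proof.
intros H.
eapply has_Cderive_eq.
- apply has_Cderive_mult; [apply has_Cderive_upow|].
  apply (has_Cderive_inv (fun v => Cexp v - 1)%C); auto.
  apply has_Cderive_minus; [apply has_Cderive_Cexp, has_Cderive_id|apply has_Cderive_const].
- unfold pole_kernel_deriv; ring.
Qed.

Lemma Ccont2_inv_sub_1 w : (Cexp w - 1)%C <> RtoC 0 -> Ccont2 (fun v => / (Cexp v - 1))%C w.
Proof.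
intros H; apply (Ccont2_inv (fun v => Cexp v - 1)%C); auto.
apply Ccont2_minus; [apply Ccont2_Cexp, Ccont2_id|apply Ccont2_const].
Qed.

Lemma Ccont2_pole_kernel s w : (Cexp w - 1)%C <> RtoC 0 -> Ccont2 (pole_kernel s) w.
Proof.
intros H; apply Ccont2_mult; [apply Ccont2_upow | now apply Ccont2_inv_sub_1].
Qed.

Lemma Ccont2_pole_kernel_deriv s w : (Cexp w - 1)%C <> RtoC 0 -> Ccont2 (pole_kernel_deriv s) w.
Proof.
intros H; unfold pole_kernel_deriv.
assert (H1 := Ccont2_inv_sub_1 w H). assert (H2 := Ccont2_upow s w).
repeat first [apply Ccont2_plus | apply Ccont2_mult | apply Ccont2_opp |
  apply Ccont2_const | assumption | apply Ccont2_Cexp, Ccont2_id].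
Qed.

Lemma Cexp_neq_1_of_re w : Re w <> 0 -> (Cexp w - 1)%C <> RtoC 0.
Proof.
intros H; apply Cmod_gt_0.
eapply Rlt_le_trans; [|apply Cmod_Cexp_sub_1_radial].
apply Rabs_pos_lt; intros E.
apply H, exp_inv; rewrite exp_0; lra.
Qed.

Lemma Cexp_neq_1_of_cos w : cos (Im w) <= 0 -> (Cexp w - 1)%C <> RtoC 0.
Proof.
intros H; apply Cmod_gt_0.
assert (H1 := proj2 (Cmod_Cexp_sub_1_left w H)); lra.
Qed.

Definition poisson (q y : R) : R := (1 - q * q) / (1 - 2 * q * cos y + q * q).
(** This is y - 2 arg (1 - q e^(i y)). As Re (1 - q e^(i y)) > 0 for q < 1, the
    arctangent gives this argument for all y, also for those beyond PI. *)
Definition poisson_prim (q y : R) : R := y + 2 * atan (q * sin y / (1 - q * cos y)).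

Lemma poisson_den q y : 0 < q < 1 -> 0 < 1 - q * cos y.
Proof. intros Hq; assert (H := COS_bound y); nra. Qed.

Lemma poisson_den2 q y : 0 < q < 1 -> 0 < 1 - 2 * q * cos y + q * q.
Proof. intros Hq; assert (H := COS_bound y); nra. Qed.

Lemma is_derive_poisson_prim q y : 0 < q < 1 ->
  is_derive (poisson_prim q) y (poisson q y).
Proof.
intros Hq; assert (H := poisson_den q y Hq); assert (H2 := poisson_den2 q y Hq).
unfold poisson_prim, poisson; auto_derive; [lra|].
assert (E := sin2_cos2 y); unfold Rsqr in E.
assert (E2 : sin y * sin y = 1 - cos y * cos y) by lra.
replace (1 + q * sin y * / (1 + - (q * cos y)) * (q * sin y * / (1 + - (q * cos y)) * 1))
  with ((1 - 2 * q * cos y + q * q) / ((1 - q * cos y) * (1 - q * cos y))).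
2: { transitivity (1 + q * q * (sin y * sin y) / ((1 - q * cos y) * (1 - q * cos y))).
     - rewrite E2; field; lra.
     - field; lra. }
match goal with |- context [?u * / (_ / _)] => replace u with
  ((q * cos y - q * q) / ((1 - q * cos y) * (1 - q * cos y))) end.
2: { transitivity ((q * cos y * (1 - q * cos y) - q * q * (sin y * sin y)) /
       ((1 - q * cos y) * (1 - q * cos y))).
     - rewrite E2; field; lra.
     - field; lra. }
field; repeat split; lra.
Qed.

Lemma continuous_poisson q y : 0 < q < 1 -> continuous (poisson q) y.
Proof.
intros Hq; assert (H2 := poisson_den2 q y Hq).
apply (ex_derive_continuous (poisson q)); unfold poisson; auto_derive; lra.
Qed.

Lemma is_RInt_poisson q a b : 0 < q < 1 ->
  is_RInt (poisson q) a b (poisson_prim q b - poisson_prim q a).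
Proof.
intros Hq; apply (is_RInt_derive (V := R_CompleteNormedModule) (poisson_prim q)).
- intros; now apply is_derive_poisson_prim.
- intros; now apply continuous_poisson.
Qed.

(** At q = 1 the quotient is cot (y / 2), so that the arctangent is
    PI / 2 - y / 2. *)
Lemma poisson_prim_1 y : 0 < y < 2 * PI -> cos y <> 1 -> poisson_prim 1 y = PI.
Proof.
intros Hy Hc; unfold poisson_prim.
assert (Hs : 0 < sin (y / 2)) by (apply sin_gt_0; lra).
replace (1 * sin y / (1 - 1 * cos y)) with (tan (PI / 2 - y / 2)).
- rewrite atan_tan by lra; field.
- unfold tan; rewrite sin_shift, cos_shift.
  replace y with (2 * (y / 2)) at 3 4 by field.
  rewrite cos_2a_sin, sin_2a; field. nra.
Qed.

Lemma poisson_prim_opp q y : poisson_prim q (- y) = - poisson_prim q y.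
Proof.
unfold poisson_prim; rewrite cos_neg, sin_neg.
replace (q * - sin y / (1 - q * cos y)) with (- (q * sin y / (1 - q * cos y)))
  by (unfold Rdiv; ring).
rewrite atan_opp; ring.
Qed.

Lemma continuity_pt_poisson_prim y : cos y <> 1 ->
  continuity_pt (fun q => poisson_prim q y) 1.
Proof.
intros H; apply continuity_pt_filterlim, (ex_derive_continuous (fun q => poisson_prim q y)).
unfold poisson_prim; auto_derive; lra.
Qed.

Lemma RtoC_neq_0 x : x <> 0 -> RtoC x <> RtoC 0.
Proof. intros H E; apply H; now apply RtoC_inj. Qed.

(** Across the line Re w = 0 the function 1 / (e^w - 1) jumps by a Poisson kernel,
    which is an approximate identity as e tends to 0. *)
Lemma inv_sub_1_jump e y :
  let q := exp (- e) in
  0 < e ->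
  (/ (Cexp (- e, y)%R - 1) - / (Cexp (e, y) - 1))%C = RtoC (- poisson q y).
Proof.
intros q He.
assert (Hq : 0 < q < 1).
{ split; [apply exp_pos|]; unfold q; rewrite <- exp_0; apply exp_increasing; lra. }
set (E := (cos y, sin y) : C).
assert (E1 : Cexp (- e, y) = (RtoC q * E)%C).
{ unfold Cexp, E, RtoC, Cmult; simpl; fold q; f_equal; ring. }
assert (E2 : Cexp (e, y) = (/ RtoC q * E)%C).
{ rewrite <- RtoC_inv by lra.
  unfold Cexp, E, RtoC, Cmult; simpl; unfold q; rewrite <- exp_Ropp, Ropp_involutive.
  f_equal; ring. }
assert (N1 := Cexp_neq_1_of_re (- e, y) ltac:(simpl; lra)).
assert (N2 := Cexp_neq_1_of_re (e, y) ltac:(simpl; lra)).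
rewrite E1 in *; rewrite E2 in *.
assert (Q0 : RtoC q <> RtoC 0) by (apply RtoC_neq_0; lra).
assert (D := poisson_den2 q y Hq).
assert (HD : RtoC (1 - 2 * q * cos y + q * q) <> RtoC 0) by (apply RtoC_neq_0; lra).
(* With E on the unit circle, e^w is q E on the left line and E / q on the right
   one; the identity below uses E * conj E = 1. *)
assert (K : ((RtoC q * E - 1) * (E - RtoC q) = - (E * RtoC (1 - 2 * q * cos y + q * q)))%C).
{ set (E' := (cos y, - sin y) : C).
  assert (HE : (E * E')%C = RtoC 1).
  { assert (HE := sin2_cos2 y); unfold Rsqr in HE.
    unfold E, E', RtoC, Cmult; simpl; f_equal; lra. }
  assert (HR : RtoC (1 - 2 * q * cos y + q * q) = (1 - RtoC q * (E + E') + RtoC q * RtoC q)%C).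
  { unfold E, E', RtoC, Cminus, Copp, Cplus, Cmult; simpl; f_equal; ring. }
  rewrite HR.
  transitivity (RtoC q * E * E - RtoC q * RtoC q * E - E + RtoC q * (E * E'))%C;
    [rewrite HE|]; ring. }
assert (N3 : (E - RtoC q)%C <> RtoC 0).
{ intros N; apply N2.
  replace (/ RtoC q * E - 1)%C with (/ RtoC q * (E - RtoC q))%C by (field; auto).
  rewrite N; ring. }
assert (NE : E <> RtoC 0).
{ intros N; rewrite N in K. apply (Cmult_neq_0 _ _ N1 N3); rewrite N, K. ring. }
unfold poisson.
replace (RtoC (- ((1 - q * q) / (1 - 2 * q * cos y + q * q))))
  with (- ((1 - RtoC q * RtoC q) / RtoC (1 - 2 * q * cos y + q * q)))%C.
2: { rewrite RtoC_opp, RtoC_div, RtoC_minus, RtoC_mult by lra; reflexivity. }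
replace (/ (/ RtoC q * E - 1))%C with (RtoC q / (E - RtoC q))%C by (field; split; auto).
replace (- ((1 - RtoC q * RtoC q) / RtoC (1 - 2 * q * cos y + q * q)))%C
  with (E * (1 - RtoC q * RtoC q) / - (E * RtoC (1 - 2 * q * cos y + q * q)))%C
  by (field; auto).
rewrite <- K; field; auto.
Qed.

Lemma poisson_le e y : 0 < e <= 1 -> Rabs y <= 3 * (PI / 2) ->
  0 <= poisson (exp (- e)) y <= 800 * (e / (Cmod (e, y) * Cmod (e, y))).
Proof.
intros He Hy.
set (q := exp (- e)).
assert (Hq : 0 < q < 1).
{ split; [apply exp_pos|]; unfold q; rewrite <- exp_0; apply exp_increasing; lra. }
assert (D := poisson_den2 q y Hq).
assert (X0 : 0 < Cmod (e, y)).
{ apply Cmod_gt_0; intros N; injection N; intros; lra. }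
assert (EX : Cmod (- e, y) = Cmod (e, y)).
{ unfold Cmod; simpl; f_equal; ring. }
assert (L := Cmod_le_Cexp_sub_1 (- e, y) ltac:(simpl; lra) ltac:(simpl; lra)).
rewrite EX in L.
assert (E := Cmod_Cexp_sub_1_sqr (- e, y)); simpl in E; fold q in E.
assert (DX : Cmod (e, y) * Cmod (e, y) <= 400 * (1 - 2 * q * cos y + q * q)).
{ replace (1 - 2 * q * cos y + q * q) with ((q - 1) * (q - 1) + 2 * q * (1 - cos y)) by ring.
  rewrite <- E; nra. }
assert (Q1 : 1 - q <= e) by (assert (H := exp_ineq1_le (- e)); fold q in H; lra).
unfold poisson; split.
- apply Rle_mult_inv_pos; [nra|auto].
- set (X2 := Cmod (e, y) * Cmod (e, y)) in *. assert (0 < X2) by (unfold X2; nra).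
  replace (800 * (e / X2)) with (2 * e / (X2 / 400)) by (field; lra).
  apply Rle_trans with (2 * e / (1 - 2 * q * cos y + q * q)).
  + apply Rmult_le_compat_r; [left; now apply Rinv_0_lt_compat|nra].
  + apply Rmult_le_compat_l; [lra|]. apply Rinv_le_contravar; lra.
Qed.

(** Since [upow s] is Lipschitz and equals 1 at the pole, the jump of [pole_kernel]
    is that of 1 / (e^w - 1) up to O(e / |w|). The stated form of this error has an
    integral over y of order sqrt e. *)
Lemma pole_kernel_jump s : exists K, 0 <= K /\ forall e y, 0 < e <= 1 ->
  Rabs y <= 3 * (PI / 2) ->
  Cmod (pole_kernel s (- e, y)%R - pole_kernel s (e, y) + RtoC (poisson (exp (- e)) y))
  <= K * (sqrt e * (1 + e / (e * e + y * y))).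
Proof.
set (m := Cmod (1 - s)).
assert (Hm : 0 <= m) by apply Cmod_ge_0.
set (A := exp (8 * m)). set (B := exp (2 * m)).
assert (HA : 0 < A) by apply exp_pos. assert (HB : 0 < B) by apply exp_pos.
assert (HK : 0 <= 800 * m * A + 40 * m * A * B).
{ assert (0 <= m * A) by (apply Rmult_le_pos; lra).
  assert (0 <= m * A * B) by (apply Rmult_le_pos; lra). lra. }
exists (800 * m * A + 40 * m * A * B); split; [exact HK|].
intros e y He Hy.
assert (X0 : 0 < Cmod (e, y)).
{ apply Cmod_gt_0; intros N; injection N; intros; lra. }
assert (EX : Cmod (- e, y) = Cmod (e, y)).
{ unfold Cmod; simpl; f_equal; ring. }
assert (X8 : Cmod (e, y) <= 8).
{ eapply Rle_trans; [apply Cmod_le_sum|]; simpl; rewrite (Rabs_pos_eq e) by lra.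
  assert (H := PI_4); lra. }
assert (XX : Cmod (e, y) * Cmod (e, y) = e * e + y * y) by apply Cmod_sqr.
set (X := Cmod (e, y)) in *.
set (P := poisson (exp (- e)) y).
assert (HP : 0 <= P <= 800 * (e / (X * X))) by now apply poisson_le.
set (hm := upow s (- e, y)%R). set (hp := upow s (e, y)).
assert (Hv : Cmod ((- e, y)%R * (1 - s)) = X * m) by (rewrite Cmod_mult, EX; reflexivity).
assert (HXm : X * m <= 8 * m) by (apply Rmult_le_compat_r; lra).
assert (Hem : 2 * e * m <= 2 * m) by (apply Rmult_le_compat_r; lra).
assert (B1 : Cmod (1 - hm) <= A * (X * m)).
{ rewrite Cmod_minus_sym; unfold hm, upow, A; rewrite <- Hv.
  apply Cexp_sub_1_bound_gen; rewrite Hv; lra. }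
assert (B2 : Cmod hm <= A).
{ unfold hm, upow, A; rewrite Cmod_Cexp; apply exp_le_mono.
  eapply Rle_trans; [apply Rle_abs|]; eapply Rle_trans; [apply re_le_Cmod|].
  rewrite Hv; lra. }
assert (B3 : Cmod (hm - hp) <= A * (B * (2 * e * m))).
{ assert (E : hp = (hm * Cexp (RtoC (2 * e) * (1 - s)))%C).
  { unfold hp, hm, upow; rewrite <- Cexp_plus; f_equal.
    replace ((e, y) : C) with ((- e, y)%R + RtoC (2 * e) : C)%C; [ring|].
    unfold RtoC, Cplus; simpl; f_equal; ring. }
  rewrite E.
  replace (hm - hm * Cexp (RtoC (2 * e) * (1 - s)))%C
    with (hm * - (Cexp (RtoC (2 * e) * (1 - s)) - 1))%C by ring.
  rewrite Cmod_mult, Cmod_opp.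
  apply Rmult_le_compat; try apply Cmod_ge_0; auto.
  assert (Hn : Cmod (RtoC (2 * e) * (1 - s)) = 2 * e * m).
  { rewrite Cmod_mult, Cmod_R, Rabs_pos_eq by lra; reflexivity. }
  rewrite <- Hn; apply Cexp_sub_1_bound_gen; rewrite Hn; lra. }
assert (N2 := Cexp_neq_1_of_re (e, y) ltac:(simpl; lra)).
assert (B4 : Cmod (/ (Cexp (e, y) - 1)) <= 20 / X).
{ rewrite Cmod_inv by auto.
  assert (L := Cmod_le_Cexp_sub_1 (e, y) ltac:(simpl; lra) ltac:(simpl; lra)).
  fold X in L.
  replace (20 / X) with (/ (X / 20)) by (field; lra).
  apply Rinv_le_contravar; lra. }
assert (J := inv_sub_1_jump e y ltac:(lra)).
replace (pole_kernel s (- e, y)%R - pole_kernel s (e, y) + RtoC P)%C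
  with ((1 - hm) * RtoC P + (hm - hp) * / (Cexp (e, y) - 1))%C.
2: { unfold pole_kernel; fold hm hp.
     replace (/ (Cexp (- e, y)%R - 1))%C with (RtoC (- P) + / (Cexp (e, y) - 1))%C.
     - rewrite RtoC_opp; ring.
     - unfold P; rewrite <- J; ring. }
eapply Rle_trans; [apply Cmod_triangle|].
rewrite !Cmod_mult, Cmod_R, Rabs_pos_eq by lra.
apply Rle_trans with ((800 * m * A + 40 * m * A * B) * (e / X)).
- apply Rle_trans with (A * (X * m) * (800 * (e / (X * X))) + A * (B * (2 * e * m)) * (20 / X)).
  + apply Rplus_le_compat; apply Rmult_le_compat; try apply Cmod_ge_0; auto; lra.
  + right; field; lra.
- apply Rmult_le_compat_l; [exact HK|].
  rewrite <- XX.
  assert (Hr := sqrt_sqrt e ltac:(lra)). assert (Hr0 := sqrt_pos e).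
  set (r := sqrt e) in *.
  rewrite <- Hr.
  (* With r = sqrt e and t = r / X the inequality is r * t <= r * (1 + t * t). *)
  replace (r * r / X) with (r * (r / X)) by (field; lra).
  replace (r * r / (X * X)) with ((r / X) * (r / X)) by (field; lra).
  apply Rmult_le_compat_l; auto. nra.
Qed.

Section Residue.
Variables (a b : R).
Hypothesis Ha : - (3 * (PI / 2)) < a < - (PI / 2).
Hypothesis Hb : PI / 2 < b < 3 * (PI / 2).

Lemma cos_a_neg : cos a < 0.
Proof. rewrite <- cos_neg; apply cos_lt_0; lra. Qed.
Lemma cos_b_neg : cos b < 0.
Proof. apply cos_lt_0; lra. Qed.
Lemma a_le_b : a <= b.
Proof. assert (H := PI_RGT_0); lra. Qed.

Lemma on_half_strip_im x0 w : on_half_strip a b x0 w -> Rabs (Im w) <= 3 * (PI / 2).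
Proof.
assert (H := PI_RGT_0).
intros [[_ [-> | ->]] | [_ [H1 H2]]]; apply Rabs_le; lra.
Qed.

Lemma on_half_strip_re x0 w : on_half_strip a b x0 w -> x0 <= Re w.
Proof. intros [[H _] | [H _]]; lra. Qed.

Lemma on_half_strip_cos x0 w : on_half_strip a b x0 w -> cos (Im w) < 0 \/ Re w = x0.
Proof.
intros [[_ [-> | ->]] | [H _]]; [left; apply cos_a_neg | left; apply cos_b_neg | now right].
Qed.

Lemma on_half_strip_Cexp_neq_1 x0 w : x0 <> 0 -> on_half_strip a b x0 w -> (Cexp w - 1)%C <> RtoC 0.
Proof.
intros H0 H; destruct (on_half_strip_cos _ _ H) as [H1|H1].
- apply Cexp_neq_1_of_cos; lra.
- apply Cexp_neq_1_of_re; lra.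
Qed.

Lemma Cmod_pole_kernel_ray s w : Im w = a \/ Im w = b ->
  Cmod (pole_kernel s w) <= upow_bound s * exp (- Re s * Re w).
Proof.
intros Hw.
assert (Hs : Rabs (Im w) <= 3 * (PI / 2)) by (apply (on_half_strip_im (Re w)); left; split; [lra|auto]).
assert (Hc : cos (Im w) <= 0).
{ destruct Hw as [-> | ->]; [left; apply cos_a_neg | left; apply cos_b_neg]. }
unfold pole_kernel; rewrite Cmod_mult, Cmod_inv by now apply Cexp_neq_1_of_cos.
replace (- Re s * Re w) with ((1 - Re s) * Re w + - Re w) by ring.
rewrite exp_plus, <- Rmult_assoc, exp_Ropp.
apply Rmult_le_compat.
- apply Cmod_ge_0.
- left; apply Rinv_0_lt_compat, Cmod_gt_0; now apply Cexp_neq_1_of_cos.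
- now apply Cmod_upow_le.
- apply Rinv_le_contravar; [apply exp_pos|]; now apply Cmod_Cexp_sub_1_left.
Qed.

Lemma ex_half_strip_int_pole_kernel s x0 : 0 < Re s -> x0 <> 0 ->
  exists l, is_half_strip_int a b (pole_kernel s) x0 l.
Proof.
intros Hs H0; apply ex_half_strip_int with (Re s) (upow_bound s); auto.
- apply a_le_b.
- intros w Hw; apply Ccont2_pole_kernel; now apply on_half_strip_Cexp_neq_1 with x0.
- intros w _ Hw; now apply Cmod_pole_kernel_ray.
Qed.

Lemma is_half_strip_int_pole_kernel_move s x1 x2 l : (0 < x1 \/ x2 < 0) -> x1 <= x2 ->
  is_half_strip_int a b (pole_kernel s) x2 l -> is_half_strip_int a b (pole_kernel s) x1 l.
Proof.
intros H0 H12.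
assert (Hd : exists x0 x3, x0 < x1 /\ x2 < x3 /\ forall x, x0 < x < x3 -> x <> 0).
{ destruct H0; [exists (x1 / 2), (x2 + 1) | exists (x1 - 1), (x2 / 2)];
  repeat split; intros; lra. }
destruct Hd as (x0 & x3 & H1 & H2 & H3).
apply (is_half_strip_int_move a b a_le_b) with (pole_kernel_deriv s) x0 x3; auto.
- intros w Hw; apply has_Cderive_pole_kernel, Cexp_neq_1_of_re; auto.
- intros w Hw; apply Ccont2_pole_kernel_deriv, Cexp_neq_1_of_re; auto.
Qed.

Lemma is_half_strip_int_pole_kernel_unmove s x1 x2 l : 0 < Re s -> (0 < x1 \/ x2 < 0) -> x1 <= x2 ->
  is_half_strip_int a b (pole_kernel s) x1 l -> is_half_strip_int a b (pole_kernel s) x2 l.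
Proof.
intros Hs H0 H12 H.
destruct (ex_half_strip_int_pole_kernel s x2 Hs) as [l' Hl']; [lra|].
assert (H' := is_half_strip_int_pole_kernel_move s x1 x2 l' H0 H12 Hl').
now rewrite (is_half_strip_int_unique a b _ _ _ _ H H').
Qed.

Lemma Rle_0_of_exp_decay A K k x0 : 0 < k ->
  (forall x, x0 <= x -> A <= K * exp (- k * x)) -> A <= 0.
Proof.
intros Hk H.
destruct (Rle_dec A 0) as [|Hn]; auto; exfalso.
assert (HK : 0 < K).
{ specialize (H x0 (Rle_refl _)); assert (H1 := exp_pos (- k * x0)); nra. }
assert (He : 0 < A / K) by (apply Rdiv_lt_0_compat; lra).
destruct (filterlim_exp_minus k Hk _ (locally_ball 0 (mkposreal _ He))) as [B HB].
set (x := Rmax x0 (B + 1)).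
assert (Hx : x0 <= x) by apply Rmax_l.
assert (Hx2 : B < x) by (assert (H1 := Rmax_r x0 (B + 1)); unfold x; lra).
specialize (HB x Hx2); specialize (H x Hx).
unfold ball in HB; simpl in HB; unfold AbsRing_ball, abs, minus, plus, opp in HB; simpl in HB.
rewrite Ropp_0, Rplus_0_r, Rabs_pos_eq in HB by (left; apply exp_pos).
apply Rmult_lt_compat_l with (r := K) in HB; auto.
replace (K * (A / K)) with A in HB by (field; lra). lra.
Qed.

(** The integral does not change when the vertical side moves to the right, and it
    tends to 0 there because Re s > 0. *)
Lemma is_half_strip_int_pole_kernel_pos s x0 : 0 < Re s -> 0 < x0 ->
  is_half_strip_int a b (pole_kernel s) x0 (RtoC 0).
Proof.
intros Hs H0.
destruct (ex_half_strip_int_pole_kernel s x0 Hs) as [l Hl]; [lra|].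
replace (RtoC 0) with l; auto.
apply Cmod_eq_0, Rle_antisym; [|apply Cmod_ge_0].
set (M := upow_bound s * 2).
apply Rle_0_of_exp_decay with ((2 / Re s + (b - a)) * M) (Re s) (Rmax x0 1); auto.
intros x Hx.
assert (Hx0 : x0 <= x) by (assert (H := Rmax_l x0 1); lra).
assert (Hx1 : 1 <= x) by (assert (H := Rmax_r x0 1); lra).
rewrite Rmult_assoc.
apply (Cmod_half_strip_int_le a b a_le_b (pole_kernel s)); auto.
- intros w Hw; apply Ccont2_pole_kernel; apply on_half_strip_Cexp_neq_1 with x; auto; lra.
- intros w Hw. assert (Hw1 := on_half_strip_re _ _ Hw).
  unfold pole_kernel; rewrite Cmod_mult, Cmod_inv by (apply on_half_strip_Cexp_neq_1 with x; auto; lra).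
  assert (L := Cmod_Cexp_sub_1_radial w).
  assert (E2 : 2 <= exp (Re w)) by (assert (H := exp_ineq1_le (Re w)); lra).
  rewrite Rabs_pos_eq in L by lra.
  replace (- Re s * Re w) with ((1 - Re s) * Re w + - Re w) by ring.
  rewrite exp_plus, exp_Ropp; unfold M.
  replace (upow_bound s * 2 * (exp ((1 - Re s) * Re w) * / exp (Re w)))
    with (upow_bound s * exp ((1 - Re s) * Re w) * / (exp (Re w) / 2)) by (field; lra).
  apply Rmult_le_compat.
  + apply Cmod_ge_0.
  + left; apply Rinv_0_lt_compat; lra.
  + apply Cmod_upow_le; now apply on_half_strip_im with x.
  + apply Rinv_le_contravar; lra.
- apply is_half_strip_int_pole_kernel_unmove with x0; auto.
Qed.

Lemma is_RInt_atan e : 0 < e ->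
  is_RInt (fun y => e / (e * e + y * y)) a b (atan (b / e) - atan (a / e)).
Proof.
intros He; apply (is_RInt_derive (V := R_CompleteNormedModule) (fun y => atan (y / e))).
- intros y _; auto_derive; [lra|]. unfold Rsqr. field. split; nra.
- intros y _; apply (ex_derive_continuous (fun y => e / (e * e + y * y))).
  auto_derive; nra.
Qed.

(** Compare with the integral at [e], which is 0: the horizontal sides differ by
    segments of length 2 e, the vertical ones by the integrated jump. *)
Lemma pole_kernel_neg_approx s l : 0 < Re s ->
  (forall e, 0 < e <= 1 -> is_half_strip_int a b (pole_kernel s) (- e) l) ->
  exists K, 0 <= K /\ forall e, 0 < e <= 1 ->
    Cmod (l + Ci * RtoC (poisson_prim (exp (- e)) b - poisson_prim (exp (- e)) a))
    <= K * sqrt e.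
Proof.
intros Hs Hl.
destruct (pole_kernel_jump s) as (K & HK & HJ).
assert (HP := PI_RGT_0).
set (M := upow_bound s * exp (Re s)).
assert (HM : 0 < M) by (apply Rmult_lt_0_compat; apply exp_pos).
assert (Hab := a_le_b). assert (Hca := cos_a_neg). assert (Hcb := cos_b_neg).
exists (4 * M + K * (b - a + PI)); split; [nra|].
intros e He.
destruct (Hl e He) as (l1 & l2 & l3 & H1 & H2 & H3 & E).
destruct (is_half_strip_int_pole_kernel_pos s e Hs ltac:(lra)) as (m1 & m2 & m3 & G1 & G2 & G3 & E').
assert (tail : forall y p q, y = a \/ y = b ->
  is_RInt_infty (fun x => pole_kernel s (x, y)) (- e) p -> is_RInt_infty (fun x => pole_kernel s (x, y)) e q ->
  Cmod (p - q) <= 2 * e * M).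
{ intros y p q Hy Hp Hq.
  assert (Hc : cos y <= 0) by (destruct Hy as [-> | ->]; lra).
  assert (HI : exists J : C, is_RInt (V := CN) (fun x => pole_kernel s (x, y)) (- e) e J).
  (* The horizontal sides stay away from the pole since cos y <= 0. *)
  { eexists; apply ex_RInt_Ccont; [lra|]; intros x _.
    apply (Ccont2_x (pole_kernel s) (x, y)), Ccont2_pole_kernel; now apply Cexp_neq_1_of_cos. }
  destruct HI as [J HI].
  rewrite (is_RInt_infty_unique _ _ _ _ Hp (is_RInt_infty_Chasles _ _ _ _ _ HI Hq)).
  replace (J + q - q)%C with J by ring.
  replace (2 * e * M) with ((e - - e) * M) by ring.
  apply (Cmod_RInt_le (fun x => pole_kernel s (x, y)) (fun _ => M) (- e) e); [lra| |exact HI|].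
  - intros x Hx. eapply Rle_trans; [now apply Cmod_pole_kernel_ray|].
    apply Rmult_le_compat_l; [left; apply exp_pos|]. apply exp_le_mono; simpl; nra.
  - apply (is_RInt_const (- e) e M). }
assert (T1 := tail a l1 m1 (or_introl eq_refl) H1 G1).
assert (T3 := tail b l3 m3 (or_intror eq_refl) H3 G3).
set (P := poisson_prim (exp (- e)) b - poisson_prim (exp (- e)) a).
assert (Hq : 0 < exp (- e) < 1).
{ split; [apply exp_pos|]; replace 1 with (exp 0) by apply exp_0; apply exp_increasing; lra. }
assert (HIP : is_RInt (V := CN) (fun y => RtoC (poisson (exp (- e)) y)) a b (RtoC P)).
{ apply is_RInt_C; simpl.
  - now apply is_RInt_poisson.
  - evar_last; [apply (is_RInt_const a b 0)|]. unfold scal; simpl; unfold mult; simpl; ring. }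
assert (arc : Cmod (l2 - m2 + RtoC P) <= K * (sqrt e * (b - a + PI))).
{ apply Rle_trans with (K * (sqrt e * ((b - a) * 1 + (atan (b / e) - atan (a / e))))).
  - apply (Cmod_RInt_le (fun y => pole_kernel s (- e, y)%R - pole_kernel s (e, y)
        + RtoC (poisson (exp (- e)) y))%C
      (fun y => K * (sqrt e * (1 + e / (e * e + y * y)))) a b); auto.
    + intros y Hy; apply HJ; auto. apply Rabs_le; lra.
    + exact (is_RInt_plus (V := CN) _ _ _ _ _ _ (is_RInt_minus (V := CN) _ _ _ _ _ _ H2 G2) HIP).
    + apply (is_RInt_scal (V := R_NormedModule)), (is_RInt_scal (V := R_NormedModule)).
      apply (is_RInt_plus (V := R_NormedModule)); [apply (is_RInt_const a b 1)|].
      apply is_RInt_atan; lra.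
  - apply Rmult_le_compat_l; auto. apply Rmult_le_compat_l; [apply sqrt_pos|].
    assert (A1 := atan_bound (b / e)). assert (A2 := atan_bound (a / e)). lra. }
replace (l + Ci * RtoC P)%C with ((l3 - m3) + - (l1 - m1) + Ci * (l2 - m2 + RtoC P))%C.
2: { rewrite E; transitivity (l3 - l1 + Ci * l2 + Ci * RtoC P - (m3 - m1 + Ci * m2))%C;
     [ring|rewrite <- E'; ring]. }
eapply Rle_trans; [apply Cmod_triangle|].
assert (T := Cmod_triangle (l3 - m3) (- (l1 - m1))).
rewrite Cmod_opp in T; rewrite Cmod_mult, Cmod_Ci.
assert (Hse : e <= sqrt e).
{ assert (Hr := sqrt_sqrt e ltac:(lra)); assert (Hr0 := sqrt_pos e).
  assert (sqrt e <= 1) by (rewrite <- sqrt_1; apply sqrt_le_1; lra). nra. }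
nra.
Qed.

(** By [pole_kernel_neg_approx] the integral is - i times the limit of the integral
    over [a, b] of the Poisson kernel with q = exp (- e), which is 2 PI. *)
Lemma is_half_strip_int_pole_kernel_neg s x0 : 0 < Re s -> x0 < 0 ->
  is_half_strip_int a b (pole_kernel s) x0 (- (RtoC 2 * RtoC PI * Ci))%C.
Proof.
intros Hs H0. assert (HP := PI_RGT_0).
destruct (ex_half_strip_int_pole_kernel s x0 Hs) as [l Hl]; [lra|].
assert (Hall : forall x, x < 0 -> is_half_strip_int a b (pole_kernel s) x l).
{ intros x Hx; destruct (Rle_dec x x0).
  - apply is_half_strip_int_pole_kernel_move with x0; auto.
  - apply is_half_strip_int_pole_kernel_unmove with x0; auto; lra. }
destruct (pole_kernel_neg_approx s l Hs) as (K & HK & HJ).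
{ intros e He; apply Hall; lra. }
assert (Hca := cos_a_neg). assert (Hcb := cos_b_neg).
set (F := fun e => poisson_prim (exp (- e)) b - poisson_prim (exp (- e)) a).
assert (HF0 : F 0 = 2 * PI).
{ unfold F; rewrite Ropp_0, exp_0.
  replace a with (- (- a)) by ring. rewrite poisson_prim_opp.
  rewrite !poisson_prim_1; try lra. rewrite cos_neg; lra. }
assert (HFc : continuity_pt F 0).
{ assert (Hc : forall y, cos y < 0 -> continuity_pt (fun e => poisson_prim (exp (- e)) y) 0).
  { intros y Hy.
    apply (continuity_pt_comp (fun e => exp (- e)) (fun q => poisson_prim q y)).
    - apply (continuity_pt_comp Ropp exp).
      + apply continuity_pt_opp, continuity_pt_id.
      + apply derivable_continuous_pt, derivable_pt_exp.
    - rewrite Ropp_0, exp_0. apply continuity_pt_poisson_prim; lra. }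
  apply (continuity_pt_minus (fun e => poisson_prim (exp (- e)) b) (fun e => poisson_prim (exp (- e)) a)); auto. }
replace (- (RtoC 2 * RtoC PI * Ci))%C with l; [exact Hl|].
assert (D : Cmod (l + Ci * RtoC (2 * PI)) = 0).
2: { apply Cmod_eq_0 in D. rewrite RtoC_mult in D.
     replace l with (l + Ci * (RtoC 2 * RtoC PI) - Ci * (RtoC 2 * RtoC PI))%C by ring.
     rewrite D; ring. }
apply Rle_antisym; [|apply Cmod_ge_0].
set (h := fun e => K * sqrt e + Rabs (F e - 2 * PI)).
assert (Hh : forall e, 0 < e <= 1 -> Cmod (l + Ci * RtoC (2 * PI)) <= h e).
{ intros e He; specialize (HJ e He); fold (F e) in HJ.
  replace (l + Ci * RtoC (2 * PI))%C with ((l + Ci * RtoC (F e)) + Ci * RtoC (2 * PI - F e))%C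
    by (rewrite RtoC_minus; ring).
  eapply Rle_trans; [apply Cmod_triangle|].
  rewrite Cmod_mult, Cmod_Ci, Cmod_R, Rmult_1_l.
  rewrite (Rabs_minus_sym (2 * PI)); unfold h; lra. }
assert (Hhc : continuity_pt h 0).
{ apply (continuity_pt_plus (fun e => K * sqrt e) (fun e => Rabs (F e - 2 * PI))).
  - apply (continuity_pt_scal sqrt), continuity_pt_sqrt; lra.
  - apply (continuity_pt_comp (fun e => F e - 2 * PI) Rabs); [|apply Rcontinuity_abs].
    apply (continuity_pt_minus F (fun _ => 2 * PI)); auto.
    apply continuity_pt_const; intros ? ?; reflexivity. }
assert (Hh0 : h 0 = 0).
{ unfold h; rewrite sqrt_0, HF0, Rminus_diag, Rabs_R0; ring. }
destruct (Rle_dec (Cmod (l + Ci * RtoC (2 * PI))) 0) as [|Hn]; auto; exfalso.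
destruct (Hhc (Cmod (l + Ci * RtoC (2 * PI))) ltac:(lra)) as (al & Hal & Hd).
set (e := Rmin (al / 2) 1).
assert (He : 0 < e <= 1).
{ unfold e; split; [apply Rmin_glb_lt; lra | apply Rmin_r]. }
assert (He2 : e <= al / 2) by apply Rmin_l.
specialize (Hd e). unfold dist in Hd; simpl in Hd; unfold Rdist in Hd.
rewrite Hh0, !Rminus_0_r in Hd.
specialize (Hh e He).
assert (Hd2 : Rabs (h e) < Cmod (l + Ci * RtoC (2 * PI))).
{ apply Hd; split.
  - split; [exact I | lra].
  - rewrite Rabs_pos_eq; lra. }
assert (H := Rle_abs (h e)). lra.
Qed.
End Residue.

(** * Hankel's integral and its functional equation *)

(** For x >= 0 one has e^x >= x^2 / 4, and completing the square bounds the
    exponent. *)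
Lemma superexp_decay tau p x0 : 0 < tau ->
  exists M, 0 <= M /\ forall x, x0 <= x -> exp (- tau * exp x + p * x) <= M * exp (- x).
Proof.
intros Ht. set (P := Rabs (p + 1)).
exists (exp (P * P / tau + P * Rabs x0)); split; [left; apply exp_pos|].
intros x Hx; rewrite <- exp_plus; apply exp_le_mono.
assert (HP : 0 <= P) by apply Rabs_pos.
assert (H0 := Rabs_pos x0).
assert (HQ : 0 <= P * P / tau) by (apply Rle_mult_inv_pos; nra).
assert (Hp : (p + 1) * x <= P * Rabs x) by (unfold P; rewrite <- Rabs_mult; apply Rle_abs).
assert (H1 := exp_pos x).
enough (- tau * exp x + P * Rabs x <= P * P / tau + P * Rabs x0) by lra.
destruct (Rle_dec 0 x) as [H|H].
- rewrite (Rabs_pos_eq x) by lra.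
  assert (E : exp x = exp (x / 2) * exp (x / 2)) by (rewrite <- exp_plus; f_equal; field).
  assert (H2 := exp_ineq1_le (x / 2)).
  assert (H3 : x * x / 4 <= exp x) by (rewrite E; nra).
  assert (H4 : - tau * exp x <= - tau * (x * x / 4)) by nra.
  assert (H5 : P * P / tau - P * x + tau * (x * x / 4) = (P - tau * x / 2) * (P - tau * x / 2) / tau)
    by (field; lra).
  assert (H6 : 0 <= (P - tau * x / 2) * (P - tau * x / 2) / tau)
    by (apply Rle_mult_inv_pos; auto; apply Rle_0_sqr).
  assert (0 <= P * Rabs x0) by nra. lra.
- assert (Rabs x <= Rabs x0) by (rewrite !Rabs_left by lra; lra).
  assert (P * Rabs x <= P * Rabs x0) by (apply Rmult_le_compat_l; auto). nra.
Qed.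

(** What e^u u^(-s) du becomes under u = e^w. *)
Definition hankel_kernel (s w : C) : C := (Cexp (Cexp w) * upow s w)%C.

Lemma Ccont2_hankel_kernel s w : Ccont2 (hankel_kernel s) w.
Proof.
apply Ccont2_mult; [|apply Ccont2_upow]. apply Ccont2_Cexp, Ccont2_Cexp, Ccont2_id.
Qed.

Lemma has_Cderive_hankel_kernel s w :
  has_Cderive (hankel_kernel s) w ((Cexp w + (1 - s)) * hankel_kernel s w)%C.
Proof.
eapply has_Cderive_eq.
- apply has_Cderive_mult; [|apply has_Cderive_upow].
  apply has_Cderive_Cexp, has_Cderive_Cexp, has_Cderive_id.
- unfold hankel_kernel; ring.
Qed.

Lemma upow_mul_Cexp s w : upow s w = (Cexp w * upow (s + 1) w)%C.
Proof. unfold upow; rewrite <- Cexp_plus; f_equal; ring. Qed.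

Section Angles.
Variables (a b : R).
Hypothesis Ha : - (3 * (PI / 2)) < a < - (PI / 2).
Hypothesis Hb : PI / 2 < b < 3 * (PI / 2).
Let Hab := a_le_b a b Ha Hb.

Lemma ray_decay T p x0 : 0 < T -> exists M, 0 <= M /\
  forall w, x0 <= Re w -> Im w = a \/ Im w = b ->
  exp (T * (exp (Re w) * cos (Im w))) * exp (p * Re w) <= M * exp (- Re w).
Proof.
intros HT.
assert (Hca := cos_a_neg a Ha). assert (Hcb := cos_b_neg b Hb).
destruct (superexp_decay (T * - cos a) p x0) as (M1 & P1 & B1); [nra|].
destruct (superexp_decay (T * - cos b) p x0) as (M2 & P2 & B2); [nra|].
exists (M1 + M2); split; [lra|].
intros w Hx Hw; rewrite <- exp_plus.
assert (He := exp_pos (- Re w)).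
destruct Hw as [E | E]; rewrite E.
- specialize (B1 _ Hx).
  replace (T * (exp (Re w) * cos a) + p * Re w) with (- (T * - cos a) * exp (Re w) + p * Re w) by ring.
  nra.
- specialize (B2 _ Hx).
  replace (T * (exp (Re w) * cos b) + p * Re w) with (- (T * - cos b) * exp (Re w) + p * Re w) by ring.
  nra.
Qed.

Lemma Cmod_hankel_kernel_ray s x0 : exists M, 0 <= M /\
  forall w, x0 <= Re w -> Im w = a \/ Im w = b ->
  Cmod (hankel_kernel s w) <= M * exp (- (1) * Re w).
Proof.
destruct (ray_decay 1 (1 - Re s) x0) as (M & HM & B); [lra|].
exists (upow_bound s * M); split.
{ apply Rmult_le_pos; auto; left; apply exp_pos. }
intros w Hx Hw; specialize (B w Hx Hw).
unfold hankel_kernel; rewrite Cmod_mult, Cmod_Cexp.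
assert (Hi : Rabs (Im w) <= 3 * (PI / 2)) by (apply (on_half_strip_im a b Ha Hb x0); left; auto).
assert (U := Cmod_upow_le s w Hi).
simpl (Re (Cexp w)). rewrite Rmult_1_l in B.
replace (- (1) * Re w) with (- Re w) by ring.
assert (HU : 0 < upow_bound s) by apply exp_pos.
apply Rle_trans with (exp (exp (Re w) * cos (Im w)) * (upow_bound s * exp ((1 - Re s) * Re w))).
- apply Rmult_le_compat_l; auto; left; apply exp_pos.
- nra.
Qed.

Lemma ex_half_strip_int_hankel s x0 : exists l, is_half_strip_int a b (hankel_kernel s) x0 l.
Proof.
destruct (Cmod_hankel_kernel_ray s x0) as (M & _ & B).
apply ex_half_strip_int with 1 M; auto; try lra.
intros; apply Ccont2_hankel_kernel.
Qed.

Lemma is_half_strip_int_hankel_move s x1 x2 l :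
  is_half_strip_int a b (hankel_kernel s) x2 l -> is_half_strip_int a b (hankel_kernel s) x1 l.
Proof.
assert (mv : forall u v m, u <= v ->
  is_half_strip_int a b (hankel_kernel s) v m -> is_half_strip_int a b (hankel_kernel s) u m).
{ intros u v m Huv.
  apply (is_half_strip_int_move a b Hab _ (fun w => (Cexp w + (1 - s)) * hankel_kernel s w)%C (u - 1) u v (v + 1)); try lra.
  - intros; apply has_Cderive_hankel_kernel.
  - intros; apply Ccont2_mult; [|apply Ccont2_hankel_kernel].
    apply Ccont2_plus; [apply Ccont2_Cexp, Ccont2_id | apply Ccont2_const]. }
intros H. destruct (Rle_dec x1 x2) as [L|L]; [now apply mv with x2|].
destruct (ex_half_strip_int_hankel s x1) as [l' Hl'].
assert (H' := mv x2 x1 l' ltac:(lra) Hl').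
now rewrite (is_half_strip_int_unique a b _ _ _ _ H H').
Qed.

(** Integration by parts: e^u u^(-s) du - s e^u u^(-s - 1) du is the differential
    of e^u u^(-s), which vanishes at both ends of the contour. In the coordinate w
    this primitive is [hankel_kernel (s + 1)]. *)
Lemma hankel_functional_eq s x0 l l' :
  is_half_strip_int a b (hankel_kernel s) x0 l -> is_half_strip_int a b (hankel_kernel (s + 1)) x0 l' ->
  l = (s * l')%C.
Proof.
intros H H'.
assert (E : forall w, ((Cexp w + (1 - (s + 1))) * hankel_kernel (s + 1) w
    = hankel_kernel s w - s * hankel_kernel (s + 1) w)%C).
{ intros w; unfold hankel_kernel at 2; rewrite upow_mul_Cexp; unfold hankel_kernel; ring. }
destruct (Cmod_hankel_kernel_ray (s + 1) x0) as (M & _ & B).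
assert (lim : forall y, y = a \/ y = b -> filterlim (fun x => hankel_kernel (s + 1) (x, y))
   (Rbar_locally p_infty) (locally (T := CN) (RtoC 0))).
{ intros y Hy; apply filterlim_C_norm with (fun x => M * exp (- (1) * x)).
  - typeclasses eauto.
  - replace 0 with (M * 0) at 1 by ring.
    eapply filterlim_comp; [apply (filterlim_exp_minus 1); lra|].
    apply (filterlim_scal_r M 0).
  - generalize (eventually_ge x0); apply filter_imp; intros x Hx.
    replace (hankel_kernel (s + 1) (x, y) - RtoC 0)%C with (hankel_kernel (s + 1) (x, y)) by ring.
    apply (B (x, y)); auto. }
assert (H0 : is_half_strip_int a b (fun w => (Cexp w + (1 - (s + 1))) * hankel_kernel (s + 1) w)%C x0 (RtoC 0)).
{ apply (is_half_strip_int_exact a b Hab (hankel_kernel (s + 1))).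
  - intros; apply has_Cderive_hankel_kernel.
  - intros; apply Ccont2_mult; [|apply Ccont2_hankel_kernel].
    apply Ccont2_plus; [apply Ccont2_Cexp, Ccont2_id | apply Ccont2_const].
  - apply lim; auto.
  - apply lim; auto. }
assert (H1 := is_half_strip_int_minus a b Hab _ _ _ _ _ H (is_half_strip_int_mult a b s _ _ _ H')).
apply (is_half_strip_int_ext a b Hab) with (g := (fun w => hankel_kernel s w - s * hankel_kernel (s + 1) w)%C) in H0;
  [|intros; apply E].
assert (D := is_half_strip_int_unique a b _ _ _ _ H0 H1).
replace l with ((l - s * l') + s * l')%C by ring.
rewrite <- D; ring.
Qed.

(** * The integral Phi and its derivative *)

(** What e^(T (u - 1)) u^(-s) / (u - 1) du becomes under u = e^w. The denominator
    u - 1 is there to be cancelled by the derivative in [T]. *)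
Definition laplace_kernel (s : C) (T : R) (w : C) : C :=
  (Cexp (RtoC T * (Cexp w - 1)) * pole_kernel s w)%C.
Definition laplace_kernel_dT (s : C) (T : R) (w : C) : C :=
  (Cexp (RtoC T * (Cexp w - 1)) * upow s w)%C.

(** The arc has radius 1 / e < 1 and the rays lie in Re u < 0, so u - 1 stays in a
    half-plane Re <= - 1 / 2 along the contour. *)
Lemma on_half_strip_Re_Cexp w : on_half_strip a b (- (1)) w -> Re (Cexp w - 1) <= - (1 / 2).
Proof.
assert (Hca := cos_a_neg a Ha). assert (Hcb := cos_b_neg b Hb).
intros H; change (Re (Cexp w - 1)) with (exp (Re w) * cos (Im w) + - (1)).
assert (He := exp_pos (Re w)).
destruct (on_half_strip_cos a b Ha Hb _ _ H) as [Hc|Hx].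
- nra.
- rewrite Hx. assert (H1 := COS_bound (Im w)).
  assert (E : exp (- (1)) * exp 1 = 1) by (rewrite <- exp_plus, Rplus_opp_l; apply exp_0).
  assert (H2 := exp_ineq1_le 1). assert (H3 := exp_pos (- (1))). nra.
Qed.

Lemma on_half_strip_Cmod_Cexp w : on_half_strip a b (- (1)) w ->
  0 < exp (Re w) <= Cmod (Cexp w - 1) /\ Cmod (Cexp w - 1) <= 1 + exp (Re w).
Proof.
intros H; assert (He := exp_pos (Re w)); repeat split; auto.
- destruct (on_half_strip_cos a b Ha Hb _ _ H) as [Hc|Hx].
  + apply Cmod_Cexp_sub_1_left; lra.
  + eapply Rle_trans; [|apply Cmod_Cexp_sub_1_radial]. rewrite Hx.
    assert (E : exp (- (1)) * exp 1 = 1) by (rewrite <- exp_plus, Rplus_opp_l; apply exp_0).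
    assert (H2 := exp_ineq1_le 1). assert (H3 := exp_pos (- (1))).
    rewrite Rabs_left1 by nra. nra.
- eapply Rle_trans; [apply Cmod_triangle|]. rewrite Cmod_opp, Cmod_1, Cmod_Cexp; lra.
Qed.

Lemma on_half_strip_Cexp_sub_1_neq_0 w : on_half_strip a b (- (1)) w -> (Cexp w - 1)%C <> RtoC 0.
Proof. intros H; apply on_half_strip_Cexp_neq_1 with a b (- (1)); auto; lra. Qed.

Lemma Cmod_pole_kernel_strip s w : on_half_strip a b (- (1)) w ->
  Cmod (pole_kernel s w) <= upow_bound s * exp (- Re s * Re w).
Proof.
intros H; unfold pole_kernel; rewrite Cmod_mult, Cmod_inv by now apply on_half_strip_Cexp_sub_1_neq_0.
destruct (on_half_strip_Cmod_Cexp w H) as [[H1 H2] _].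
replace (- Re s * Re w) with ((1 - Re s) * Re w + - Re w) by ring.
rewrite exp_plus, <- Rmult_assoc, exp_Ropp.
apply Rmult_le_compat.
- apply Cmod_ge_0.
- left; apply Rinv_0_lt_compat; lra.
- apply Cmod_upow_le; now apply (on_half_strip_im a b Ha Hb (- (1))).
- apply Rinv_le_contravar; auto.
Qed.

Lemma Ccont2_Cexp_scal T w : Ccont2 (fun v => Cexp (RtoC T * (Cexp v - 1))) w.
Proof.
apply Ccont2_Cexp, Ccont2_mult; [apply Ccont2_const|].
apply Ccont2_minus; [apply Ccont2_Cexp, Ccont2_id | apply Ccont2_const].
Qed.

Lemma Ccont2_laplace_kernel s T w : on_half_strip a b (- (1)) w -> Ccont2 (laplace_kernel s T) w.
Proof.
intros H; apply Ccont2_mult; [apply Ccont2_Cexp_scal|].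
now apply Ccont2_pole_kernel, on_half_strip_Cexp_sub_1_neq_0.
Qed.

Lemma Ccont2_laplace_kernel_dT s T w : Ccont2 (laplace_kernel_dT s T) w.
Proof. apply Ccont2_mult; [apply Ccont2_Cexp_scal | apply Ccont2_upow]. Qed.

Lemma Cmod_laplace_kernel s T w : 0 <= T -> on_half_strip a b (- (1)) w ->
  Cmod (laplace_kernel s T w) <= exp (- (1 / 2) * T) * upow_bound s * exp (- Re s * Re w).
Proof.
intros HT H; unfold laplace_kernel; rewrite Cmod_mult, Cmod_Cexp, Re_scal, Rmult_assoc.
apply Rmult_le_compat; [left; apply exp_pos | apply Cmod_ge_0 | |now apply Cmod_pole_kernel_strip].
apply exp_le_mono; assert (H1 := on_half_strip_Re_Cexp w H); nra.
Qed.

Lemma strip_decay T p : 0 < T -> exists M, 0 <= M /\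
  forall w, on_half_strip a b (- (1)) w ->
  exp (T * Re (Cexp w - 1)) * exp (p * Re w) <= M * exp (- Re w).
Proof.
intros HT.
destruct (ray_decay T p (- (1)) HT) as (M & HM & B).
exists (M + exp (- p - 1)); split; [assert (H := exp_pos (- p - 1)); lra|].
intros w H.
assert (H1 := on_half_strip_Re_Cexp w H).
assert (P1 := exp_pos (p * Re w)). assert (P2 := exp_pos (- Re w)).
assert (P3 := exp_pos (- p - 1)).
destruct H as [[Hx Hy]|[Hx Hy]].
- specialize (B w Hx Hy).
  assert (exp (T * Re (Cexp w - 1)) <= exp (T * (exp (Re w) * cos (Im w)))).
  { apply exp_le_mono; apply Rmult_le_compat_l; [lra|].
    change (Re (Cexp w - 1)) with (exp (Re w) * cos (Im w) + - (1)); lra. }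
  nra.
- assert (E : exp (T * Re (Cexp w - 1)) <= 1) by (apply exp_le_1; nra).
  assert (E2 : exp (p * Re w) = exp (- p - 1) * exp (- Re w)).
  { rewrite <- exp_plus, Hx; f_equal; ring. }
  rewrite E2 in *. nra.
Qed.

(** Replacing u by u / T shifts the vertical side by ln T, and Hankel's integral
    does not depend on the position of that side. *)
Lemma is_half_strip_int_laplace_kernel_dT s T l : 0 < T ->
  is_half_strip_int a b (hankel_kernel s) (- (1)) l ->
  is_half_strip_int a b (laplace_kernel_dT s T) (- (1))
    (Cexp ((s - 1) * RtoC (ln T)) * RtoC (exp (- T)) * l)%C.
Proof.
intros HT Hl.
apply (is_half_strip_int_ext a b Hab) with
  (fun w => Cexp ((s - 1) * RtoC (ln T)) * RtoC (exp (- T)) * hankel_kernel s (w + RtoC (ln T)))%C.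
- intros w _. unfold hankel_kernel, laplace_kernel_dT, upow.
  rewrite (Cexp_plus w), Cexp_RtoC, exp_ln by auto.
  rewrite <- Cexp_RtoC, <- !Cexp_plus. 
  rewrite RtoC_opp; f_equal; ring.
- apply (is_half_strip_int_mult a b); apply is_half_strip_int_shift.
  + intros; apply Ccont2_hankel_kernel.
  + now apply is_half_strip_int_hankel_move with (- (1)).
Qed.

(** A second-order remainder, with the decay that allows its integration along the
    contour; half of the exponent T (u - 1) is kept for that decay. *)
Lemma laplace_kernel_taylor s T : 0 < T -> exists M, 0 <= M /\
  forall h w, - (T / 2) <= h -> on_half_strip a b (- (1)) w ->
  Cmod (laplace_kernel s (T + h) w - laplace_kernel s T w - RtoC h * laplace_kernel_dT s T w)
  <= (h * h * M) * exp (- (1) * Re w).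
Proof.
intros HT.
destruct (strip_decay (T / 2) (1 - Re s)) as (M1 & P1 & B1); [lra|].
destruct (strip_decay (T / 2) (2 - Re s)) as (M2 & P2 & B2); [lra|].
assert (HU : 0 < upow_bound s) by apply exp_pos.
exists (upow_bound s * (M1 + M2)); split; [apply Rmult_le_pos; lra|].
intros h w Hh H.
specialize (B1 w H); specialize (B2 w H).
set (u := (Cexp w - 1)%C).
assert (Hu := on_half_strip_Cexp_sub_1_neq_0 w H). fold u in Hu.
assert (Hre := on_half_strip_Re_Cexp w H). fold u in Hre, B1, B2.
destruct (on_half_strip_Cmod_Cexp w H) as [[H1 H2] H3]. fold u in H2, H3.
set (E := exp (T / 2 * Re u)) in *.
assert (HE : 0 < E) by apply exp_pos.
assert (key : Cmod (Cexp (RtoC (T + h) * u) - Cexp (RtoC T * u) - RtoC h * u * Cexp (RtoC T * u))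
   <= E * (h * h * (Cmod u * Cmod u))).
{ destruct (Rle_dec 0 h) as [L|L].
  - replace (Cexp (RtoC (T + h) * u)) with (Cexp (RtoC T * u) * Cexp (RtoC h * u))%C
      by (rewrite <- Cexp_plus, RtoC_plus; f_equal; ring).
    replace (Cexp (RtoC T * u) * Cexp (RtoC h * u) - Cexp (RtoC T * u) - RtoC h * u * Cexp (RtoC T * u))%C
      with (Cexp (RtoC T * u) * (Cexp (RtoC h * u) - 1 - RtoC h * u))%C by ring.
    rewrite Cmod_mult; apply Rmult_le_compat; try apply Cmod_ge_0.
    + rewrite Cmod_Cexp, Re_scal; apply exp_le_mono; nra.
    + eapply Rle_trans; [apply Cexp_taylor_at_0; rewrite Re_scal; nra|].
      rewrite Cmod_mult, Cmod_R, Rabs_pos_eq by auto; right; ring.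
  - replace (Cexp (RtoC T * u)) with (Cexp (RtoC (T + h) * u) * Cexp (RtoC (- h) * u))%C
      by (rewrite <- Cexp_plus, RtoC_plus, RtoC_opp; f_equal; ring).
    replace (Cexp (RtoC (T + h) * u) - Cexp (RtoC (T + h) * u) * Cexp (RtoC (- h) * u)
       - RtoC h * u * (Cexp (RtoC (T + h) * u) * Cexp (RtoC (- h) * u)))%C
      with (Cexp (RtoC (T + h) * u) *
        (1 - Cexp (RtoC (- h) * u) + RtoC (- h) * u * Cexp (RtoC (- h) * u)))%C
      by (rewrite RtoC_opp; ring).
    rewrite Cmod_mult; apply Rmult_le_compat; try apply Cmod_ge_0.
    + rewrite Cmod_Cexp, Re_scal; apply exp_le_mono; nra.
    + eapply Rle_trans; [apply Cexp_taylor_at_end; rewrite Re_scal; nra|].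
      rewrite Cmod_mult, Cmod_R, Rabs_pos_eq by lra; right; ring. }
replace (laplace_kernel s (T + h) w - laplace_kernel s T w - RtoC h * laplace_kernel_dT s T w)%C
  with ((Cexp (RtoC (T + h) * u) - Cexp (RtoC T * u) - RtoC h * u * Cexp (RtoC T * u))
        * (upow s w * / u))%C.
2: { unfold laplace_kernel, laplace_kernel_dT, pole_kernel; fold u; field; auto. }
rewrite !Cmod_mult, Cmod_inv by auto.
assert (U := Cmod_upow_le s w (on_half_strip_im a b Ha Hb _ _ H)).
assert (Hmu : 0 < Cmod u) by lra.
apply Rle_trans with (E * (h * h * (Cmod u * Cmod u)) *
  (upow_bound s * exp ((1 - Re s) * Re w) * / Cmod u)).
{ apply Rmult_le_compat; auto; try apply Cmod_ge_0.
  - apply Rmult_le_pos; [apply Cmod_ge_0|left; now apply Rinv_0_lt_compat].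
  - apply Rmult_le_compat_r; auto; left; now apply Rinv_0_lt_compat. }
replace (E * (h * h * (Cmod u * Cmod u)) * (upow_bound s * exp ((1 - Re s) * Re w) * / Cmod u))
  with (h * h * (upow_bound s * (Cmod u * (E * exp ((1 - Re s) * Re w))))) by (field; lra).
replace (h * h * (upow_bound s * (M1 + M2)) * exp (- (1) * Re w))
  with (h * h * (upow_bound s * ((M1 + M2) * exp (- Re w)))).
2: { replace (- (1) * Re w) with (- Re w) by ring; ring. }
apply Rmult_le_compat_l; [apply Rle_0_sqr|].
apply Rmult_le_compat_l; [lra|].
assert (Hp := exp_pos ((1 - Re s) * Re w)).
apply Rle_trans with ((1 + exp (Re w)) * (E * exp ((1 - Re s) * Re w))).
- apply Rmult_le_compat_r; auto; left; now apply Rmult_lt_0_compat.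
- replace ((1 + exp (Re w)) * (E * exp ((1 - Re s) * Re w)))
    with (E * exp ((1 - Re s) * Re w) + E * exp ((2 - Re s) * Re w)); [lra|].
  replace ((2 - Re s) * Re w) with (Re w + (1 - Re s) * Re w) by ring.
  rewrite (exp_plus (Re w)); ring.
Qed.

Lemma is_Cderive_of_quadratic (f : R -> C) t d K r : 0 < r ->
  (forall h, Rabs h <= r -> Cmod (f (t + h)%R - f t - RtoC h * d) <= K * (h * h)) ->
  is_Cderive f t d.
Proof.
intros Hr H.
assert (main : forall p : C -> R, (forall c, Rabs (p c) <= Cmod c) ->
  (forall u v w h, p (u - v - RtoC h * w)%C = p u - p v - h * p w) ->
  is_derive (fun u => p (f u)) t (p d)).
{ intros p Hp Hlin; apply is_derive_Reals; intros eps He.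
  set (K' := Rabs K + 1). assert (HK' : 0 < K') by (assert (A := Rabs_pos K); unfold K'; lra).
  assert (Hdel : 0 < Rmin r (eps / K')).
  { apply Rmin_glb_lt; auto; now apply Rdiv_lt_0_compat. }
  exists (mkposreal _ Hdel); intros h H0 Hh; simpl in Hh.
  assert (A1 := Rmin_l r (eps / K')). assert (A2 := Rmin_r r (eps / K')).
  assert (B := H h ltac:(lra)).
  assert (B2 := Hp (f (t + h)%R - f t - RtoC h * d)%C). rewrite Hlin in B2.
  assert (Hh0 : 0 < Rabs h) by now apply Rabs_pos_lt.
  replace ((p (f (t + h)) - p (f t)) / h - p d) with ((p (f (t + h)) - p (f t) - h * p d) * / h)
    by (field; auto).
  rewrite Rabs_mult, Rabs_inv.
  apply Rle_lt_trans with (K * (h * h) * / Rabs h).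
  - apply Rmult_le_compat_r; [left; now apply Rinv_0_lt_compat|lra].
  - replace (h * h) with (Rabs h * Rabs h) by (rewrite <- Rabs_mult; apply Rabs_pos_eq, Rle_0_sqr).
    replace (K * (Rabs h * Rabs h) * / Rabs h) with (K * Rabs h) by (field; lra).
    assert (K * Rabs h <= Rabs K * Rabs h) by (apply Rmult_le_compat_r; [lra|apply Rle_abs]).
    assert (Rabs h < eps / K') by lra.
    assert (K' * Rabs h < K' * (eps / K')) by now apply Rmult_lt_compat_l.
    replace (K' * (eps / K')) with eps in * by (field; lra).
    unfold K' in *; lra. }
split; apply main.
- apply re_le_Cmod.
- intros; unfold Re; simpl; ring.
- apply im_le_Cmod.
- intros; unfold Im; simpl; ring.
Qed.

Lemma ex_half_strip_int_laplace s T : 0 < Re s -> 0 <= T -> exists l, is_half_strip_int a b (laplace_kernel s T) (- (1)) l.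
Proof.
intros Hs HT. 
apply ex_half_strip_int with (Re s) (exp (- (1 / 2) * T) * upow_bound s); auto.
- intros w H; now apply Ccont2_laplace_kernel.
- intros w Hx Hy; apply Cmod_laplace_kernel; auto; left; auto.
Qed.

Lemma Rpower_min X k : 0 < X -> 0 < k < 1 -> 1 <= Rpower X k \/ X <= Rpower X k.
Proof.
intros HX Hk; destruct (Rle_dec 1 X) as [H|H].
- left; unfold Rpower; rewrite <- exp_0 at 1; apply exp_le_mono.
  assert (0 <= ln X) by (rewrite <- ln_1; apply ln_le; lra). nra.
- right; unfold Rpower. rewrite <- (exp_ln X) at 1 by auto. apply exp_le_mono.
  assert (ln X <= 0) by (rewrite <- ln_1; apply ln_le; lra). nra.
Qed.

(** |e^(T (u - 1)) - 1| is at most 2 and at most T |u - 1|, hence at most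
    2 (T |u - 1|)^k. For k < Re s this factor leaves the kernel integrable along the
    rays, and it makes the integral tend to its value at T = 0. *)
Lemma laplace_kernel_at_0 s T k w : 0 < T -> 0 < k < 1 -> on_half_strip a b (- (1)) w ->
  Cmod (laplace_kernel s T w - pole_kernel s w)
  <= 2 * Rpower T k * upow_bound s * exp (- (Re s - k) * Re w).
Proof.
intros HT Hk H.
set (u := (Cexp w - 1)%C).
assert (Hu := on_half_strip_Cexp_sub_1_neq_0 w H). fold u in Hu.
assert (Hre := on_half_strip_Re_Cexp w H). fold u in Hre.
destruct (on_half_strip_Cmod_Cexp w H) as [[H1 H2] H3]. fold u in H2, H3.
assert (U := Cmod_upow_le s w (on_half_strip_im a b Ha Hb _ _ H)).
replace (laplace_kernel s T w - pole_kernel s w)%C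
  with ((Cexp (RtoC T * u) - 1) * (upow s w * / u))%C
  by (unfold laplace_kernel, pole_kernel; fold u; ring).
rewrite !Cmod_mult, Cmod_inv by auto.
assert (Hmu : 0 < Cmod u) by lra.
assert (B : Cmod (Cexp (RtoC T * u) - 1) <= 2 * Rpower (T * Cmod u) k).
{ destruct (Rpower_min (T * Cmod u) k) as [L|L]; auto; [now apply Rmult_lt_0_compat| |].
  - eapply Rle_trans; [apply Cmod_triangle|].
    rewrite Cmod_opp, Cmod_1, Cmod_Cexp, Re_scal.
    assert (exp (T * Re u) <= 1) by (apply exp_le_1; nra). lra.
  - eapply Rle_trans; [apply Cexp_sub_1_bound; rewrite Re_scal; nra|].
    rewrite Cmod_mult, Cmod_R, Rabs_pos_eq by lra. 
    assert (0 < T * Cmod u) by now apply Rmult_lt_0_compat. lra. }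
rewrite <- Rpower_mult_distr in B by auto.
assert (C1 : Rpower (Cmod u) k * / Cmod u <= exp ((k - 1) * Re w)).
{ unfold Rpower. rewrite <- (exp_ln (Cmod u)) at 2 by auto.
  rewrite <- exp_Ropp, <- exp_plus. apply exp_le_mono.
  assert (Re w <= ln (Cmod u)) by (rewrite <- (ln_exp (Re w)); now apply ln_le). nra. }
assert (PT : 0 < Rpower T k) by apply exp_pos.
assert (Pu : 0 < Rpower (Cmod u) k) by apply exp_pos.
assert (Pi : 0 < / Cmod u) by now apply Rinv_0_lt_compat.
apply Rle_trans with (2 * (Rpower T k * Rpower (Cmod u) k) *
   (upow_bound s * exp ((1 - Re s) * Re w) * / Cmod u)).
{ apply Rmult_le_compat; auto; try apply Cmod_ge_0.
  - apply Rmult_le_pos; [apply Cmod_ge_0|lra].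
  - apply Rmult_le_compat_r; auto; lra. }
replace (2 * (Rpower T k * Rpower (Cmod u) k) * (upow_bound s * exp ((1 - Re s) * Re w) * / Cmod u))
  with (2 * Rpower T k * upow_bound s * (exp ((1 - Re s) * Re w) * (Rpower (Cmod u) k * / Cmod u))) by ring.
apply Rmult_le_compat_l.
{ assert (HU : 0 < upow_bound s) by apply exp_pos.
  apply Rmult_le_pos; [|lra]. lra. }
replace (- (Re s - k) * Re w) with ((1 - Re s) * Re w + (k - 1) * Re w) by ring.
rewrite exp_plus; apply Rmult_le_compat_l; auto; left; apply exp_pos.
Qed.
End Angles.

(** * Hankel's formula for the reciprocal Gamma function *)

(** The integral as a total function, so that it can be differentiated with respect
    to a parameter. *)
Definition half_strip_int (a b : R) (g : C -> C) (x0 : R) : C :=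
  (RInt_gen (V := CV) (fun x => g (x, b)) (at_point x0) (Rbar_locally p_infty)
   - RInt_gen (V := CV) (fun x => g (x, a)) (at_point x0) (Rbar_locally p_infty)
   + Ci * RInt (V := CV) (fun y => g (x0, y)) a b)%C.

Lemma half_strip_int_unique a b g x0 l : is_half_strip_int a b g x0 l -> half_strip_int a b g x0 = l.
Proof.
intros (l1 & l2 & l3 & H1 & H2 & H3 & ->); unfold half_strip_int.
rewrite (is_RInt_gen_unique (V := CV) _ _ H1), (is_RInt_gen_unique (V := CV) _ _ H3).
now rewrite (is_RInt_unique (V := CV) _ _ _ _ H2).
Qed.

Lemma half_strip_int_correct a b g x0 : (exists l, is_half_strip_int a b g x0 l) ->
  is_half_strip_int a b g x0 (half_strip_int a b g x0).
Proof. intros [l Hl]; now rewrite (half_strip_int_unique _ _ _ _ _ Hl). Qed.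

Definition gamma_integrand (s : C) (t : R) : C :=
  (Cexp ((s - 1) * RtoC (ln t)) * RtoC (exp (- t)))%C.

Lemma is_Cderive_ln t : 0 < t -> is_Cderive (fun t => RtoC (ln t)) t (RtoC (/ t)).
Proof. intros Ht; apply is_Cderive_RtoC; auto_derive; auto; field; lra. Qed.

Lemma Ccont_gamma_integrand s t : 0 < t -> Ccont (gamma_integrand s) t.
Proof.
intros Ht; eapply is_Cderive_continuous; unfold gamma_integrand.
apply is_Cderive_mult.
- apply is_Cderive_Cexp, is_Cderive_mult; [apply is_Cderive_const | now apply is_Cderive_ln].
- apply (is_Cderive_RtoC (fun t => exp (- t)) t (- exp (- t))).
  auto_derive; auto; ring.
Qed.

Section Angles.
Variables (a b : R).
Hypothesis Ha : - (3 * (PI / 2)) < a < - (PI / 2).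
Hypothesis Hb : PI / 2 < b < 3 * (PI / 2).
Let Hab := a_le_b a b Ha Hb.
Variables (s l : C).
Hypothesis Hs : 0 < Re s.
Hypothesis Hl : is_half_strip_int a b (hankel_kernel s) (- (1)) l.

Definition laplace_int (T : R) : C := half_strip_int a b (laplace_kernel s T) (- (1)).

Lemma is_half_strip_int_laplace_int T : 0 <= T ->
  is_half_strip_int a b (laplace_kernel s T) (- (1)) (laplace_int T).
Proof. intros HT; apply half_strip_int_correct; now apply ex_half_strip_int_laplace. Qed.

Lemma is_Cderive_laplace_int T : 0 < T ->
  is_Cderive laplace_int T (gamma_integrand s T * l)%C.
Proof.
intros HT.
destruct (laplace_kernel_taylor a b Ha Hb s T HT) as (M & HM & B).
apply is_Cderive_of_quadratic with ((2 / 1 + (b - a)) * (M * exp (- (1) * - (1)))) (T / 2); [lra|].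
intros h Hh. assert (Hh' := Rabs_le_between h (T / 2)). destruct Hh' as [Hh' _].
specialize (Hh' Hh).
apply Rle_trans with ((2 / 1 + (b - a)) * (h * h * M * exp (- (1) * - (1)))).
2: { right; ring. }
apply (Cmod_half_strip_int_le a b Hab (fun w => laplace_kernel s (T + h) w - laplace_kernel s T w
    - RtoC h * laplace_kernel_dT s T w)%C); [lra| | |].
- intros w Hw; apply Ccont2_minus; [apply Ccont2_minus|apply Ccont2_mult];
  try (apply Ccont2_laplace_kernel with a b; assumption);
  [apply Ccont2_const | apply Ccont2_laplace_kernel_dT].
- intros w Hw; apply B; auto; lra.
- apply is_half_strip_int_minus; auto; [apply is_half_strip_int_minus; auto; apply is_half_strip_int_laplace_int; lra|].
  apply is_half_strip_int_mult. now apply is_half_strip_int_laplace_kernel_dT.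
Qed.

Lemma is_RInt_gamma_integrand u v : 0 < u -> u <= v ->
  is_RInt (V := CN) (fun t => gamma_integrand s t * l)%C u v (laplace_int v - laplace_int u)%C.
Proof.
intros Hu Huv; apply is_RInt_Cderive; auto.
- intros t Ht; apply is_Cderive_laplace_int; lra.
- intros t Ht; eapply filterlim_ext; [intros x; apply Cmult_comm|].
  rewrite Cmult_comm.
  eapply filterlim_comp; [apply (Ccont_gamma_integrand s t); lra|].
  apply filterlim_Cmult_const.
Qed.

Lemma laplace_int_at_0 : laplace_int 0 = (- (RtoC 2 * RtoC PI * Ci))%C.
Proof.
unfold laplace_int; apply half_strip_int_unique.
apply (is_half_strip_int_ext a b Hab) with (pole_kernel s).
- intros w _; unfold laplace_kernel; rewrite Cmult_0_l, Cexp_0; ring.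
- apply is_half_strip_int_pole_kernel_neg; auto; lra.
Qed.

Lemma laplace_int_bounds : exists K k, 0 <= K /\ 0 < k /\
  (forall T, 0 < T -> Cmod (laplace_int T) <= K * exp (- (1 / 2) * T)) /\
  (forall T, 0 < T -> Cmod (laplace_int T - laplace_int 0) <= K * exp (k * ln T)).
Proof.
(* Any exponent with 0 < k < 1 and k < Re s would do in [laplace_kernel_at_0]. *)
set (k := Rmin (Re s) 1 / 2).
assert (Hk : 0 < k < 1 /\ k < Re s).
{ assert (A1 := Rmin_l (Re s) 1). assert (A2 := Rmin_r (Re s) 1).
  assert (0 < Rmin (Re s) 1) by (apply Rmin_glb_lt; lra). unfold k; lra. }
set (K1 := (2 / Re s + (b - a)) * (upow_bound s * exp (- Re s * - (1)))).
set (K2 := (2 / (Re s - k) + (b - a)) * (2 * upow_bound s * exp (- (Re s - k) * - (1)))).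
assert (HU : 0 < upow_bound s) by apply exp_pos.
assert (Q : forall c, 0 < c -> 0 <= 2 / c + (b - a)).
{ intros c Hc; assert (0 <= 2 / c) by (apply Rle_mult_inv_pos; lra). lra. }
assert (HK1 : 0 <= K1).
{ apply Rmult_le_pos; auto. apply Rmult_le_pos; left; [auto|apply exp_pos]. }
assert (HK2 : 0 <= K2).
{ apply Rmult_le_pos; [apply Q; lra|]. apply Rmult_le_pos; [lra|left;apply exp_pos]. }
exists (K1 + K2), k; repeat split; [lra|apply Hk| |].
- intros T HT.
  assert (B := Cmod_half_strip_int_le a b Hab (laplace_kernel s T) (- (1)) (Re s)
    (exp (- (1 / 2) * T) * upow_bound s) (laplace_int T) Hs
    (fun w Hw => Ccont2_laplace_kernel a b Ha Hb s T w Hw)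
    (fun w Hw => Cmod_laplace_kernel a b Ha Hb s T w ltac:(lra) Hw)
    (is_half_strip_int_laplace_int T ltac:(lra))).
  eapply Rle_trans; [exact B|].
  assert (HE := exp_pos (- (1 / 2) * T)).
  apply Rle_trans with (K1 * exp (- (1 / 2) * T)); [right; unfold K1; ring|nra].
- intros T HT. change (exp (k * ln T)) with (Rpower T k).
  assert (HE : 0 < Rpower T k) by apply exp_pos.
  apply Rle_trans with (K2 * Rpower T k); [|nra].
  apply Rle_trans with ((2 / (Re s - k) + (b - a)) *
    (2 * Rpower T k * upow_bound s * exp (- (Re s - k) * - (1)))); [|right; unfold K2; ring].
  apply (Cmod_half_strip_int_le a b Hab (fun w => laplace_kernel s T w - laplace_kernel s 0 w)%C); [lra| | |].
  + intros w Hw; apply Ccont2_minus; apply Ccont2_laplace_kernel with a b; auto.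
  + intros w Hw.
    replace (laplace_kernel s 0 w) with (pole_kernel s w)
      by (unfold laplace_kernel; rewrite Cmult_0_l, Cexp_0; ring).
    apply (laplace_kernel_at_0 a b); auto; lra.
  + apply is_half_strip_int_minus; auto; apply is_half_strip_int_laplace_int; lra.
Qed.

Lemma at_right_0_lt (P : R -> Prop) d : 0 < d -> (forall x, 0 < x < d -> P x) -> at_right 0 P.
Proof.
intros Hd H; exists (mkposreal d Hd); intros y Hy H0; apply H; split; auto.
unfold ball in Hy; simpl in Hy; unfold AbsRing_ball, abs, minus, plus, opp in Hy; simpl in Hy.
rewrite Ropp_0, Rplus_0_r, Rabs_pos_eq in Hy; lra.
Qed.

Lemma filterlim_Rpower_0 k : 0 < k -> filterlim (fun t => exp (k * ln t)) (at_right 0) (locally 0).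
Proof.
intros Hk P [eps HP].
apply at_right_0_lt with (exp (ln eps / k)); [apply exp_pos|].
intros x Hx; apply HP.
unfold ball; simpl; unfold AbsRing_ball, abs, minus, plus, opp; simpl.
rewrite Ropp_0, Rplus_0_r, Rabs_pos_eq by (left; apply exp_pos).
rewrite <- (exp_ln eps) by apply cond_pos; apply exp_increasing.
assert (H : ln x < ln eps / k) by (rewrite <- (ln_exp (ln eps / k)); apply ln_increasing; lra).
apply Rmult_lt_compat_l with (r := k) in H; auto.
replace (k * (ln eps / k)) with (ln eps) in H by (field; lra). lra.
Qed.

(** [laplace_int] is a primitive of [gamma_integrand s] times [l], with limit
    - 2 PI i at 0 and 0 at +oo. This increment is not 0, so neither is [l], and
    dividing by [l] yields the convergence of Euler's integral and its value. *)
Lemma is_gamma_integral :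
  l <> RtoC 0 /\
  is_RInt_gen (V := CN) (gamma_integrand s) (at_right 0) (Rbar_locally p_infty)
    (RtoC 2 * RtoC PI * Ci / l)%C.
Proof.
destruct laplace_int_bounds as (K & k & HK & Hk & B1 & B2).
set (F := filter_prod (at_right 0) (Rbar_locally p_infty)).
set (J := (RtoC 2 * RtoC PI * Ci)%C).
set (err := fun uv : R * R => K * exp (k * ln (fst uv)) + K * exp (- (1 / 2) * snd uv)).
assert (Herr : filterlim err F (locally 0)).
{ replace 0 with (K * 0 + K * 0) by ring.
  apply (filterlim_comp_2 (G := locally (K * 0)) (H := locally (K * 0))
    (fun uv => K * exp (k * ln (fst uv))) (fun uv => K * exp (- (1 / 2) * snd uv)) Rplus).
  - eapply filterlim_comp; [|apply (filterlim_scal_r K 0)].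
    eapply (filterlim_comp _ _ _ fst (fun t => exp (k * ln t))); [apply filterlim_fst|].
    now apply filterlim_Rpower_0.
  - eapply filterlim_comp; [|apply (filterlim_scal_r K 0)].
    eapply (filterlim_comp _ _ _ snd (fun t => exp (- (1 / 2) * t))); [apply filterlim_snd|].
    apply filterlim_exp_minus; lra.
  - apply (filterlim_plus (K * 0) (K * 0)). }
assert (Hdom : F (fun uv => 0 < fst uv /\ fst uv <= snd uv)).
{ exists (fun u => 0 < u < 1) (fun v => 1 <= v).
  - apply at_right_0_lt with 1; [lra|auto].
  - apply eventually_ge.
  - simpl; intros; lra. }
(* The two ends of the interval of integration contribute one term each to err. *)
assert (Hb' : forall u v, 0 < u -> u <= v -> Cmod (laplace_int v - laplace_int u - J) <= err (u, v)).
{ intros u v Hu Huv.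
  replace (laplace_int v - laplace_int u - J)%C
    with (- (laplace_int u - laplace_int 0) + laplace_int v)%C.
  2: { rewrite laplace_int_at_0; unfold J; ring. }
  eapply Rle_trans; [apply Cmod_triangle|]. rewrite Cmod_opp.
  unfold err; simpl. apply Rplus_le_compat; [apply B2 | apply B1]; lra. }
assert (FF : ProperFilter F) by (unfold F; typeclasses eauto).
assert (L : filterlim (fun uv => laplace_int (snd uv) - laplace_int (fst uv))%C F (locally (T := CN) J)).
{ apply filterlim_C_norm with err; auto.
  - typeclasses eauto.
  - revert Hdom; apply filter_imp; intros [u v] [H1 H2]; now apply Hb'. }
assert (Hl0 : l <> RtoC 0).
{ intros E.
  assert (Z : J = RtoC 0).
  { apply Cmod_eq_0, Rle_antisym; [|apply Cmod_ge_0].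
    apply (Cmod_lim_le F _ J 0 L).
    revert Hdom; apply filter_imp; intros [u v] [H1 H2]; simpl in *.
    assert (I1 := is_RInt_gamma_integrand u v H1 H2).
    assert (I2 : is_RInt (V := CN) (fun t => gamma_integrand s t * l)%C u v (RtoC 0)).
    { apply (is_RInt_ext (V := CN) (fun _ => RtoC 0)).
      - intros; rewrite E; symmetry; apply Cmult_0_r.
      - evar_last; [apply (is_RInt_const (V := CN) u v (RtoC 0))|].
        apply (scal_zero_r (V := CN)). }
    rewrite (is_RInt_C_unique _ _ _ _ _ I1 I2), Cmod_0; lra. }
  assert (HJ : Cmod J = 2 * PI).
  { unfold J; rewrite !Cmod_mult, Cmod_Ci, !Cmod_R, !Rabs_pos_eq; assert (HP := PI_RGT_0); lra. }
  rewrite Z, Cmod_0 in HJ; assert (HP := PI_RGT_0); lra. }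
split; auto.
intros Q HQ.
replace (J / l)%C with (/ l * J)%C in HQ by (field; auto).
assert (HQ' := L _ (filterlim_Cmult_const (/ l) J Q HQ)).
unfold filtermap, filtermapi in *.
generalize (filter_and _ _ Hdom HQ'); apply filter_imp; intros [u v] [[H1 H2] H3]; simpl in *.
eexists; split; [|exact H3].
apply (is_RInt_ext (V := CN) (fun t => / l * (gamma_integrand s t * l))%C).
- intros t _; change (/ l * (gamma_integrand s t * l) = gamma_integrand s t)%C; field; auto.
- apply is_RInt_Cmult_const; now apply is_RInt_gamma_integrand.
Qed.

Lemma Gamma_int_hankel : l <> RtoC 0 /\ Gamma_int s = (RtoC 2 * RtoC PI * Ci / l)%C.
Proof.
destruct is_gamma_integral as [H0 H]; split; auto.
unfold Gamma_int; apply (is_RInt_gen_unique (V := CV)).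
apply (is_RInt_gen_ext (V := CN) (gamma_integrand s)); auto.
exists (fun u => 0 < u < 1) (fun v => 1 <= v).
- apply at_right_0_lt with 1; [lra|auto].
- apply eventually_ge.
- simpl; intros u v Hu Hv x; rewrite Rmin_left by lra; intros Hx.
  unfold gamma_integrand, Cpow_arg; rewrite Cmod_R, Rabs_pos_eq by lra.
  f_equal; f_equal; ring.
Qed.
End Angles.

Lemma rising_hankel a b : - (3 * (PI / 2)) < a < - (PI / 2) -> PI / 2 < b < 3 * (PI / 2) ->
  forall x0 s n l l',
  is_half_strip_int a b (hankel_kernel s) x0 l ->
  is_half_strip_int a b (hankel_kernel (s + RtoC (INR n))) x0 l' ->
  l = (rising s n * l')%C.
Proof.
intros Ha Hb x0 s n; induction n as [|n IH]; intros l l' H H'.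
- simpl. replace (s + RtoC (INR 0))%C with s in H' by (simpl; ring).
  rewrite (is_half_strip_int_unique _ _ _ _ _ _ H H'); ring.
- destruct (ex_half_strip_int_hankel a b Ha Hb (s + RtoC (INR n)) x0) as [m Hm].
  rewrite (IH l m H Hm).
  assert (E : m = ((s + RtoC (INR n)) * l')%C).
  { apply (hankel_functional_eq a b Ha Hb _ x0 m l'); auto.
    rewrite S_INR, RtoC_plus in H'.
    now replace (s + RtoC (INR n) + 1)%C with (s + (RtoC (INR n) + 1))%C by ring. }
  rewrite E; simpl; ring.
Qed.

Lemma Gamma_shift_pos s : 0 < Re (s + RtoC (INR (Gamma_shift s))).
Proof.
unfold Gamma_shift.
change (Re (s + RtoC (INR (Z.to_nat (up (- Re s)))))) with (Re s + INR (Z.to_nat (up (- Re s)))).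
destruct (archimed (- Re s)) as [H _].
rewrite INR_IZR_INZ.
destruct (Z_le_dec 0 (up (- Re s))) as [L|L].
- rewrite Z2Nat.id by auto; lra.
- replace (Z.to_nat (up (- Re s))) with 0%nat by lia. simpl.
  assert (IZR (up (- Re s)) < 0) by (apply IZR_lt; lia). lra.
Qed.

Lemma Cinv_0 : (/ RtoC 0)%C = RtoC 0.
Proof. unfold Cinv, RtoC; simpl; f_equal; unfold Rdiv; ring. Qed.

Lemma two_pi_i_neq_0 : (RtoC 2 * RtoC PI * Ci)%C <> RtoC 0.
Proof.
apply Cmod_gt_0; rewrite !Cmod_mult, Cmod_Ci, !Cmod_R.
assert (HP := PI_RGT_0); rewrite !Rabs_pos_eq; lra.
Qed.

(** Hankel's formula. [Gamma] is defined by Euler's integral at s + n and the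
    functional equation, which Hankel's integral satisfies as well. *)
Lemma inv_Gamma_hankel a b s x0 l :
  - (3 * (PI / 2)) < a < - (PI / 2) -> PI / 2 < b < 3 * (PI / 2) ->
  is_half_strip_int a b (hankel_kernel s) x0 l ->
  (/ Gamma s)%C = (l / (RtoC 2 * RtoC PI * Ci))%C.
Proof.
intros Ha Hb H.
apply is_half_strip_int_hankel_move with (x1 := - (1)) in H; auto.
set (n := Gamma_shift s).
destruct (ex_half_strip_int_hankel a b Ha Hb (s + RtoC (INR n)) (- (1))) as [l' H'].
rewrite (rising_hankel a b Ha Hb _ _ _ _ _ H H').
destruct (Gamma_int_hankel a b Ha Hb _ l' (Gamma_shift_pos s) H') as [Hl' HG].
unfold Gamma; fold n; fold n in HG; rewrite HG.
assert (HJ := two_pi_i_neq_0).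
set (J := (RtoC 2 * RtoC PI * Ci)%C) in *.
destruct (Ceq_dec (rising s n) (RtoC 0)) as [E|E].
(* At a pole of Gamma both sides are 0, by the convention on division by 0. *)
- rewrite E; unfold Cdiv; rewrite Cinv_0, Cmult_0_r, Cinv_0; ring.
- field; auto.
Qed.

(** * The Mittag-Leffler function *)

Lemma Cmod_hankel_kernel_strip a b s x0 :
  - (3 * (PI / 2)) < a < - (PI / 2) -> PI / 2 < b < 3 * (PI / 2) ->
  exists M, 0 <= M /\ forall w, on_half_strip a b x0 w ->
  Cmod (hankel_kernel s w) <= M * exp (- (1) * Re w).
Proof.
intros Ha Hb.
destruct (Cmod_hankel_kernel_ray a b Ha Hb s x0) as (M & HM & B).
set (A := exp (exp x0) * (upow_bound s * exp ((1 - Re s) * x0)) * exp x0).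
assert (HA : 0 < A) by (repeat apply Rmult_lt_0_compat; apply exp_pos).
exists (M + A); split; [lra|].
intros w H; assert (HE := exp_pos (- (1) * Re w)).
assert (Hi := on_half_strip_im a b Ha Hb _ _ H).
destruct H as [[Hx Hy]|[Hx Hy]].
- specialize (B w Hx Hy). nra.
- apply Rle_trans with (A * exp (- (1) * Re w)); [|nra].
  unfold A; rewrite Hx. rewrite !Rmult_assoc, <- (exp_plus x0).
  replace (x0 + - (1) * x0) with 0 by ring. rewrite exp_0, Rmult_1_r, <- Hx.
  unfold hankel_kernel; rewrite Cmod_mult, Cmod_Cexp.
  apply Rmult_le_compat; [left; apply exp_pos|apply Cmod_ge_0| |now apply Cmod_upow_le].
  apply exp_le_mono. change (Re (Cexp w)) with (exp (Re w) * cos (Im w)).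
  assert (H1 := COS_bound (Im w)); assert (H2 := exp_pos (Re w)); nra.
Qed.

Section Main.
Variables (rho : R) (mu z : C) (x0 q a b : R).
Hypothesis Hrho : 0 < rho.
Hypothesis Hq : 0 <= q < 1.
Hypothesis Hx0 : Cmod z * exp (- (x0 / rho)) = q.
Hypothesis Ha : - (3 * (PI / 2)) < a < - (PI / 2).
Hypothesis Hb : PI / 2 < b < 3 * (PI / 2).
Let Hab := a_le_b a b Ha Hb.

(** The point 1 / zeta in terms of w, where (z zeta)^rho = e^w. *)
Definition zeta_inv (w : C) : C := (z * Cexp (- (w * RtoC (/ rho))))%C.

(** The integrand in zeta is (1 / rho) [ML_kernel] dw: the factor 1 / (zeta - 1)
    becomes 1 / (1 - 1 / zeta) because d zeta = zeta dw / rho. *)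
Definition ML_kernel (w : C) : C := (hankel_kernel mu w * / (1 - zeta_inv w))%C.

Lemma Cmod_zeta_inv w : x0 <= Re w -> Cmod (zeta_inv w) <= q.
Proof.
intros H; unfold zeta_inv; rewrite Cmod_mult, Cmod_Cexp, <- Hx0.
apply Rmult_le_compat_l; [apply Cmod_ge_0|]. apply exp_le_mono.
replace (Re (- (w * RtoC (/ rho)))) with (- (Re w / rho)) by (unfold Re, RtoC; simpl; field; lra).
apply Ropp_le_contravar, Rmult_le_compat_r; auto; left; now apply Rinv_0_lt_compat.
Qed.

Lemma Cmod_1_sub_zeta_inv w : x0 <= Re w -> 1 - q <= Cmod (1 - zeta_inv w).
Proof.
intros H; assert (H1 := Cmod_zeta_inv w H).
assert (H2 := Cmod_triangle (1 - zeta_inv w) (zeta_inv w)).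
replace (1 - zeta_inv w + zeta_inv w)%C with (RtoC 1) in H2 by ring.
rewrite Cmod_1 in H2; lra.
Qed.

Lemma sub_zeta_inv_neq_0 w : x0 <= Re w -> (1 - zeta_inv w)%C <> RtoC 0.
Proof. intros H; apply Cmod_gt_0; assert (H1 := Cmod_1_sub_zeta_inv w H); lra. Qed.

Lemma Ccont2_zeta_inv w : Ccont2 zeta_inv w.
Proof.
apply Ccont2_mult; [apply Ccont2_const|].
apply Ccont2_Cexp, Ccont2_opp, Ccont2_mult; [apply Ccont2_id | apply Ccont2_const].
Qed.

Lemma Ccont2_ML_kernel w : x0 <= Re w -> Ccont2 ML_kernel w.
Proof.
intros H; apply Ccont2_mult; [apply Ccont2_hankel_kernel|].
apply (Ccont2_inv (fun w => 1 - zeta_inv w)%C); [|now apply sub_zeta_inv_neq_0].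
apply Ccont2_minus; [apply Ccont2_const | apply Ccont2_zeta_inv].
Qed.

Lemma Ccont2_pow f n w : Ccont2 f w -> Ccont2 (fun v => f v ^ n)%C w.
Proof.
intros H; induction n as [|n IH]; simpl; [apply Ccont2_const|now apply Ccont2_mult].
Qed.

(** What remains of [ML_kernel] after [n] terms of the geometric series in
    1 / zeta. *)
Definition ML_rest (n : nat) (w : C) : C := (ML_kernel w * zeta_inv w ^ n)%C.

Lemma Ccont2_ML_rest n w : x0 <= Re w -> Ccont2 (ML_rest n) w.
Proof.
intros H; apply Ccont2_mult; [now apply Ccont2_ML_kernel | apply Ccont2_pow, Ccont2_zeta_inv].
Qed.

Lemma Cmod_ML_rest : exists M, 0 <= M /\ forall n w, on_half_strip a b x0 w ->
  Cmod (ML_rest n w) <= (q ^ n * M) * exp (- (1) * Re w).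
Proof.
destruct (Cmod_hankel_kernel_strip a b mu x0 Ha Hb) as (M & HM & B).
exists (M / (1 - q)); split; [apply Rle_mult_inv_pos; lra|].
intros n w H; specialize (B w H); assert (Hx := on_half_strip_re _ _ _ _ H).
unfold ML_rest, ML_kernel.
rewrite !Cmod_mult, Cmod_pow, Cmod_inv by now apply sub_zeta_inv_neq_0.
assert (H1 := Cmod_1_sub_zeta_inv w Hx).
replace (q ^ n * (M / (1 - q)) * exp (- (1) * Re w))
  with (M * exp (- (1) * Re w) * / (1 - q) * q ^ n) by (field; lra).
apply Rmult_le_compat.
- apply Rmult_le_pos; [apply Cmod_ge_0|left; apply Rinv_0_lt_compat; lra].
- apply pow_le, Cmod_ge_0.
- apply Rmult_le_compat; auto; [apply Cmod_ge_0|left; apply Rinv_0_lt_compat; lra|].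
  apply Rinv_le_contravar; lra.
- apply pow_incr; split; [apply Cmod_ge_0 | now apply Cmod_zeta_inv].
Qed.

(** 1 / zeta = z u^(- 1 / rho). *)
Lemma hankel_kernel_term n w :
  (z ^ n * hankel_kernel (mu + RtoC (INR n / rho)) w = hankel_kernel mu w * zeta_inv w ^ n)%C.
Proof.
assert (E : (zeta_inv w ^ n = z ^ n * Cexp (- (w * RtoC (INR n / rho))))%C).
{ induction n as [|n IH].
  - simpl INR. replace (0 / rho) with 0 by (field; lra). simpl Cpow.
    replace (- (w * RtoC 0))%C with (RtoC 0) by ring. rewrite Cexp_0; ring.
  - simpl Cpow; rewrite IH.
    replace (- (w * RtoC (INR (S n) / rho)))%C
      with (- (w * RtoC (/ rho)) + - (w * RtoC (INR n / rho)))%C.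
    + unfold zeta_inv at 1; rewrite Cexp_plus; ring.
    + rewrite S_INR. replace ((INR n + 1) / rho) with (/ rho + INR n / rho) by (field; lra).
      rewrite RtoC_plus; ring. }
rewrite E; unfold hankel_kernel, upow.
replace (w * (1 - (mu + RtoC (INR n / rho))))%C
  with (w * (1 - mu) + - (w * RtoC (INR n / rho)))%C by ring.
rewrite Cexp_plus; ring.
Qed.

Definition ML_term (n : nat) : C := (z ^ n / Gamma (mu + RtoC (INR n / rho)))%C.
Definition ML_partial (n : nat) : C :=
  (sum_n (fun k => Re (ML_term k)) n, sum_n (fun k => Im (ML_term k)) n).

Let J := (RtoC 2 * RtoC PI * Ci)%C.

Lemma is_half_strip_int_ML_term n :
  is_half_strip_int a b (fun w => hankel_kernel mu w * zeta_inv w ^ n)%C x0 (J * ML_term n)%C.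
Proof.
destruct (ex_half_strip_int_hankel a b Ha Hb (mu + RtoC (INR n / rho)) x0) as [l Hl].
apply (is_half_strip_int_ext a b Hab) with (fun w => z ^ n * hankel_kernel (mu + RtoC (INR n / rho)) w)%C.
{ intros; apply hankel_kernel_term. }
unfold ML_term, Cdiv; rewrite (inv_Gamma_hankel a b _ x0 l Ha Hb Hl); fold J.
replace (J * (z ^ n * (l / J)))%C with (z ^ n * l)%C by (field; apply two_pi_i_neq_0).
now apply is_half_strip_int_mult.
Qed.

Lemma ML_rest_S n w : x0 <= Re w ->
  (ML_rest n w - hankel_kernel mu w * zeta_inv w ^ n)%C = ML_rest (S n) w.
Proof.
intros H; unfold ML_rest, ML_kernel; simpl; field; now apply sub_zeta_inv_neq_0.
Qed.

Lemma is_half_strip_int_ML_rest l n : is_half_strip_int a b ML_kernel x0 l ->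
  is_half_strip_int a b (ML_rest (S n)) x0 (l - J * ML_partial n)%C.
Proof.
intros Hl; induction n as [|n IH].
- apply (is_half_strip_int_ext a b Hab) with (fun w => ML_rest 0 w - hankel_kernel mu w * zeta_inv w ^ 0)%C.
  { intros w Hw; apply ML_rest_S; now apply on_half_strip_re with a b. }
  replace (ML_partial 0) with (ML_term 0).
  2: { unfold ML_partial; rewrite !sum_O; now destruct (ML_term 0). }
  apply is_half_strip_int_minus; auto; [|apply is_half_strip_int_ML_term].
  apply (is_half_strip_int_ext a b Hab) with ML_kernel; auto.
  intros w _; unfold ML_rest; simpl; ring.
- apply (is_half_strip_int_ext a b Hab) with (fun w => ML_rest (S n) w - hankel_kernel mu w * zeta_inv w ^ (S n))%C.
  { intros w Hw; apply ML_rest_S; now apply on_half_strip_re with a b. }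
  replace (ML_partial (S n)) with (ML_partial n + ML_term (S n))%C.
  2: { unfold ML_partial; rewrite !sum_Sn; reflexivity. }
  replace (l - J * (ML_partial n + ML_term (S n)))%C
    with (l - J * ML_partial n - J * ML_term (S n))%C by ring.
  apply is_half_strip_int_minus; auto; apply is_half_strip_int_ML_term.
Qed.

Lemma ex_half_strip_int_ML_kernel : exists l, is_half_strip_int a b ML_kernel x0 l.
Proof.
destruct Cmod_ML_rest as (M & _ & B).
apply ex_half_strip_int with 1 M; auto; [lra| |].
- intros w Hw; apply Ccont2_ML_kernel; now apply on_half_strip_re with a b.
- intros w Hx Hy. specialize (B 0%nat w (or_introl (conj Hx Hy))).
  unfold ML_rest in B; simpl in B; rewrite Cmult_1_r, Rmult_1_l in B; exact B.
Qed.

(** The partial sums differ from the integral by the integral of [ML_rest], which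
    is O(q^n). *)
Lemma Mittag_Leffler_half_strip l : is_half_strip_int a b ML_kernel x0 l ->
  Mittag_Leffler rho mu z = (l / J)%C.
Proof.
intros Hl.
destruct Cmod_ML_rest as (M & HM & B).
set (K := (2 / 1 + (b - a)) * (M * exp (- (1) * x0)) / Cmod J).
assert (HJ : J <> RtoC 0) by apply two_pi_i_neq_0. assert (HJ' := proj1 (Cmod_gt_0 _) HJ).
assert (L : filterlim ML_partial eventually (locally (T := CN) (l / J)%C)).
{ apply filterlim_C_norm with (fun n => K * q ^ S n).
  - typeclasses eauto.
  - replace 0 with (K * 0) by ring.
    eapply filterlim_comp; [|apply (filterlim_scal_r K 0)].
    apply (is_lim_seq_incr_1 (fun n => q ^ n) 0).
    apply is_lim_seq_geom; rewrite Rabs_pos_eq; lra.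
  - exists 0%nat; intros n _.
    assert (H := Cmod_half_strip_int_le a b Hab (ML_rest (S n)) x0 1 (q ^ S n * M) _ ltac:(lra)
      (fun w Hw => Ccont2_ML_rest (S n) w (on_half_strip_re a b _ _ Hw)) (B (S n))
      (is_half_strip_int_ML_rest l n Hl)).
    replace (ML_partial n - l / J)%C with (- ((l - J * ML_partial n) / J))%C by (field; auto).
    rewrite Cmod_opp, Cmod_div by auto.
    replace (K * q ^ S n) with ((2 / 1 + (b - a)) * (q ^ S n * M * exp (- (1) * x0)) / Cmod J)
      by (unfold K; field; lra).
    apply Rmult_le_compat_r; auto; left; now apply Rinv_0_lt_compat. }
unfold Mittag_Leffler, CSeries.
rewrite (surjective_pairing (l / J)%C); f_equal; apply is_series_unique.
- exact (filterlim_comp _ _ _ _ _ _ _ _ L (filterlim_Re _)).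
- exact (filterlim_comp _ _ _ _ _ _ _ _ L (filterlim_Im _)).
Qed.
End Main.

Lemma polar_Cexp r theta : 0 < r -> polar r theta = Cexp (ln r, theta).
Proof. intros H; unfold polar, Cexp; simpl; now rewrite exp_ln. Qed.

Lemma ML_integrand_log rho mu z phi s theta : 0 < rho -> is_arg z phi -> 1 < s ->
  (ML_integrand rho mu z phi s theta * polar s theta)%C
  = ML_kernel rho mu z (rho * (ln (Cmod z) + ln s), rho * (phi + theta)).
Proof.
intros Hr [Hz0 Hz] Hs.
assert (Hm : 0 < Cmod z) by now apply Cmod_gt_0.
assert (Hc : Cmod (polar s theta) = s).
{ rewrite polar_Cexp, Cmod_Cexp by lra; apply exp_ln; lra. }
assert (Hp1 : (polar s theta - 1)%C <> RtoC 0).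
{ intros E. assert (E1 : polar s theta = RtoC 1).
  { replace (polar s theta) with (polar s theta - 1 + 1)%C by ring. rewrite E; ring. }
  rewrite E1, Cmod_1 in Hc; lra. }
assert (Hp0 : polar s theta <> RtoC 0) by (apply Cmod_gt_0; lra).
set (w := (rho * (ln (Cmod z) + ln s), rho * (phi + theta)) : C).
assert (Hw : (RtoC rho * (RtoC (ln (Cmod (z * polar s theta))) + Ci * RtoC (phi + theta)))%C = w).
{ rewrite Cmod_mult, Hc, ln_mult by lra.
  unfold w, RtoC, Ci, Cmult, Cplus; simpl; f_equal; ring. }
assert (Hzi : zeta_inv rho z w = (/ polar s theta)%C).
{ unfold zeta_inv. rewrite Hz, !polar_Cexp by lra.
  rewrite <- Cexp_opp, <- Cexp_plus; f_equal.
  unfold w, RtoC, Cmult, Cplus, Copp; simpl.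
  f_equal; field; lra. }
unfold ML_integrand, ML_kernel; rewrite Hzi.
unfold Cpow_arg, hankel_kernel, upow.
replace (RtoC rho * (1 - mu) * (RtoC (ln (Cmod (z * polar s theta))) + Ci * RtoC (phi + theta)))%C
  with (w * (1 - mu))%C by (rewrite <- Hw; ring).
rewrite Hw; field; auto.
Qed.

Theorem theorem1 (rho delta1 delta2 eps : R)
    (hrho : 1 / 2 < rho)
    (hdelta1 : PI / (2 * rho) < delta1 <= Rmin PI (PI / rho))
    (hdelta2 : PI / (2 * rho) < delta2 <= Rmin PI (PI / rho))
    (heps : 0 < eps)
    (mu z : C) (phi : R)
    (hphi : is_arg z phi)
    (hz : PI / (2 * rho) - delta2 + PI < phi < - (PI / (2 * rho)) + delta1 + PI) :
  exists I : C,
    is_contour_integral eps delta1 delta2 (ML_integrand rho mu z phi) I /\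
    Mittag_Leffler rho mu z = (RtoC rho / (RtoC 2 * RtoC PI * Ci) * I)%C.
Proof.
assert (HP := PI_RGT_0).
assert (Hr : 0 < rho) by lra.
set (a := rho * (phi - delta1 - PI)). set (b := rho * (phi + delta2 - PI)).
assert (D1 : delta1 <= PI / rho) by (eapply Rle_trans; [apply hdelta1|apply Rmin_r]).
assert (D2 : delta2 <= PI / rho) by (eapply Rle_trans; [apply hdelta2|apply Rmin_r]).
assert (R1 : rho * (PI / rho) = PI) by (field; lra).
assert (R2 : rho * (PI / (2 * rho)) = PI / 2) by (field; lra).
(* The upper bound of a and the lower bound of b are the condition on phi. For the
   others, a > PI / 2 - rho * (delta1 + delta2) >= - 3 PI / 2, and likewise for b. *)
assert (Ha : - (3 * (PI / 2)) < a < - (PI / 2)) by (unfold a; split; nra).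
assert (Hb : PI / 2 < b < 3 * (PI / 2)) by (unfold b; split; nra).
assert (Hm : 0 < Cmod z) by (apply Cmod_gt_0, hphi).
set (q := / (1 + eps)).
assert (Hq : 0 <= q < 1).
{ unfold q; split; [left; apply Rinv_0_lt_compat; lra|].
  rewrite <- Rinv_1; apply Rinv_lt_contravar; lra. }
set (x := fun s => rho * (ln (Cmod z) + ln s)).
assert (Hx0 : Cmod z * exp (- (x (1 + eps) / rho)) = q).
{ unfold x; replace (- (rho * (ln (Cmod z) + ln (1 + eps)) / rho))
    with (- ln (Cmod z) + - ln (1 + eps)) by (field; lra).
  rewrite exp_plus, !exp_Ropp, !exp_ln by lra. unfold q; field; lra. }
destruct (ex_half_strip_int_ML_kernel rho mu z (x (1 + eps)) q a b Hr Hq Hx0 Ha Hb) as [l Hl].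
assert (HML := Mittag_Leffler_half_strip rho mu z (x (1 + eps)) q a b Hr Hq Hx0 Ha Hb l Hl).
destruct Hl as (l1 & l2 & l3 & H1 & H2 & H3 & E).
assert (Hr0 : RtoC rho <> RtoC 0) by (apply RtoC_neq_0; lra).
(* On a ray ds / s = dx / rho. *)
assert (ray : forall theta m, is_RInt_infty (fun t => ML_kernel rho mu z (t, rho * (phi + theta))) (x (1 + eps)) m ->
  is_RInt_infty (fun s => ML_integrand rho mu z phi s theta * polar 1 theta)%C (1 + eps) (/ RtoC rho * m)%C).
{ intros theta m Hm'.
  apply is_RInt_infty_ext with (fun s => / RtoC rho * (RtoC (rho / s) * ML_kernel rho mu z (x s, (rho * (phi + theta))%R)))%C.
  { intros s Hs; unfold x; rewrite <- ML_integrand_log by (auto; lra).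
    replace (polar s theta) with (RtoC s * polar 1 theta)%C.
    - rewrite RtoC_div by lra.
      assert (RtoC s <> RtoC 0) by (apply RtoC_neq_0; lra). field; auto.
    - unfold polar, RtoC, Cmult; simpl; f_equal; ring. }
  apply is_RInt_infty_mult.
  apply (is_RInt_infty_comp (fun t => ML_kernel rho mu z (t, rho * (phi + theta))) x (fun s => rho / s)); auto.
  - intros s Hs; unfold x; auto_derive; [lra|field; lra].
  - intros s Hs; apply (ex_derive_continuous (fun s => rho / s)); auto_derive; lra.
  - intros s Hs; unfold x; apply Rmult_le_compat_l; [lra|].
    apply Rplus_le_compat_l, ln_le; lra.
  - intros P [B HB]. exists (exp (B / rho - ln (Cmod z))); intros s Hs; apply HB.
    unfold x. 
    assert (H : B / rho - ln (Cmod z) < ln s).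
    { rewrite <- (ln_exp (B / rho - ln (Cmod z))); apply ln_increasing; auto; apply exp_pos. }
    assert (Hlt : rho * (B / rho) < rho * (ln (Cmod z) + ln s)) by (apply Rmult_lt_compat_l; lra).
    replace (rho * (B / rho)) with B in Hlt by (field; lra). exact Hlt.
  - intros t Ht. apply (Ccont2_x (ML_kernel rho mu z) (t, rho * (phi + theta))).
    apply (Ccont2_ML_kernel rho mu z (x (1 + eps)) q); auto. }
assert (Ea : a = rho * (phi + (- delta1 - PI))) by (unfold a; ring).
assert (Eb : b = rho * (phi + (delta2 - PI))) by (unfold b; ring).
exists (/ RtoC rho * l)%C; split.
- exists (- (/ RtoC rho * l1))%C, (Ci * (/ RtoC rho * l2))%C, (/ RtoC rho * l3)%C.
  split; [|split; [|split]].
  + rewrite Ea in H1; apply ray in H1.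
    exact (is_RInt_gen_swap (V := CN) _ _ H1).
  + apply (is_RInt_ext (V := CN)) with
      (fun theta => Ci * (/ RtoC rho * (RtoC rho * ML_kernel rho mu z (x (1 + eps)%R, (rho * theta + rho * phi)%R))))%C.
    { intros theta _. replace (rho * theta + rho * phi) with (rho * (phi + theta)) by ring.
      unfold x; rewrite <- ML_integrand_log by (auto; lra).
      set (F := ML_integrand _ _ _ _ _ _). set (p := polar _ _).
      change (Ci * (/ RtoC rho * (RtoC rho * (F * p))) = F * (Ci * p))%C. field; auto. }
    apply is_RInt_Cmult_const, is_RInt_Cmult_const.
    assert (H2' : is_RInt (V := CN) (fun y => ML_kernel rho mu z (x (1 + eps), y))
      (rho * (- delta1 - PI) + rho * phi) (rho * (delta2 - PI) + rho * phi) l2).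
    { replace (rho * (- delta1 - PI) + rho * phi) with a by (unfold a; ring).
      replace (rho * (delta2 - PI) + rho * phi) with b by (unfold b; ring). exact H2. }
    apply (is_RInt_ext (V := CN)) with (2 := is_RInt_comp_lin (V := CN) _ _ _ _ _ _ H2').
    intros theta _. unfold scal; simpl; unfold prod_scal, Cmult, RtoC; simpl.
    unfold scal; simpl; unfold mult; simpl; f_equal; ring.
  + rewrite Eb in H3; apply ray in H3. exact H3.
  + rewrite E; ring.
- rewrite HML; assert (HJ := two_pi_i_neq_0).
  set (J := (RtoC 2 * RtoC PI * Ci)%C) in *; field; auto.
Qed.
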